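(* Let $q$ be an odd prime power. Every non-classical orthogonal Buekenhout-Metz unital $\mathcal U_{a,b}$ in $\mathrm{PG}(2,q^2)$ contains a BM-special Triple O'Nan configuration, with the exception of the conic unitals for $q=3$ and $q=5$ (which contain no BM-special Triple O'Nan configuration).
   Context: Points of $\mathrm{PG}(2,q^2)$ are written in homogeneous coordinates $(x,y,z)$. For $q$ odd and $a,b\in\mathbb F_{q^2}$ such that $d=(b-b^q)^2+4a^{q+1}$ is a non-square in $\mathbb F_q$, the orthogonal Buekenhout-Metz (BM) unital is $$\mathcal U_{a,b}=\{(x,ax^2+bx^{q+1}+r,1)\mid r\in\mathbb F_q,\ x\in\mathbb F_{q^2}\}\cup\{T_\infty=(0,1,0)\}.$$ It is classical if and only if $a=0$. The point $T_\infty$ is called the special point. A conic unital is a non-classical BM unital of the form $\mathcal U_{a,0}$ (in which case $a$ is necessarily a non-square in $\mathbb F_{q^2}$), or one equivalent to such a unital under the automorphism group of the plane $\mathrm{PG}(2,q^2)$. A Triple O'Nan configuration of $\mathcal U$ is a set of six lines arising as follows: there is a quadrangle of four points of $\mathcal U$ (no three collinear) such that, for each of the three partitions of the four points into two pairs, the two lines joining the pairs meet in a point of $\mathcal U$; the six lines joining pairs of the four points form the Triple O'Nan. It is called BM-special if one of its six lines (as a line of $\mathrm{PG}(2,q^2)$) contains $T_\infty$. *)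

(* Defs.v *)
From HB Require Import structures.
From mathcomp Require Import all_boot all_order all_algebra all_field.

Set Implicit Arguments.
Unset Strict Implicit.
Unset Printing Implicit Defensive.

Import GRing.Theory.
Local Open Scope ring_scope.

(* The projective plane PG(2, F): points and lines are the subspaces of F^3   *)
(* of dimension 1 and 2, and incidence is inclusion.                          *)

Definition point (F : fieldType) :=
  {P : {vspace 'rV[F]_3} | \dim P == 1%N}.

Definition line (F : fieldType) :=
  {L : {vspace 'rV[F]_3} | \dim L == 2%N}.

Definition incident (F : fieldType) (P : point F) (L : line F) : bool :=
  (val P <= val L)%VS.

Definition collinear (F : fieldType) (P Q R : point F) : Prop :=
  exists L : line F, [/\ incident P L, incident Q L & incident R L].

Definition vec3 (F : fieldType) (x y z : F) : 'rV[F]_3 :=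
  \row_(i < 3) [:: x; y; z]`_i.

Definition has_coords (F : fieldType) (P : point F) (x y z : F) : bool :=
  val P == <[vec3 x y z]>%VS.

Lemma vec3_010_neq0 (F : fieldType) : vec3 (0 : F) 1 0 != 0.
Proof. by apply/eqP => /rowP/(_ 1); rewrite !mxE /=; apply/eqP/oner_neq0. Qed.

Lemma T_infty_subproof (F : fieldType) :
  \dim <[vec3 (0 : F) 1 0]> == 1%N.
Proof. by rewrite dim_vline vec3_010_neq0. Qed.

Definition T_infty (F : fieldType) : point F :=
  Sub <[vec3 (0 : F) 1 0]>%VS (T_infty_subproof F).

Definition plane_automorphism (F : fieldType) (f : point F -> point F) : Prop :=
  bijective f /\
  exists g : line F -> line F,
    bijective g /\ forall P L, incident (f P) (g L) = incident P L.

Definition equivalent (F : fieldType) (U V : {pred point F}) : Prop :=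
  exists f : point F -> point F,
    plane_automorphism f /\ forall P, (f P \in V) = (P \in U).

(* From here on F has order q ^ 2, so that its subfield of order q is         *)
(* {r | r ^+ q = r} and t |-> t ^+ q is its involutory automorphism.          *)

Definition in_Fq (F : finFieldType) (q : nat) : {pred F} :=
  [pred r : F | r ^+ q == r].

Definition nonsquare_in_Fq (F : finFieldType) (q : nat) (d : F) : Prop :=
  d \in in_Fq q /\ forall s : F, s \in in_Fq q -> s ^+ 2 <> d.

Definition BM_parameters (F : finFieldType) (q : nat) (a b : F) : Prop :=
  nonsquare_in_Fq q ((b - b ^+ q) ^+ 2 + 4%:R * a ^+ q.+1).

Definition BM_unital (F : finFieldType) (q : nat) (a b : F) : {pred point F} :=
  [pred P : point F |
    (P == T_infty F) ||
    [exists x : F, exists r : F,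
      (r \in in_Fq q) &&
      has_coords P x (a * x ^+ 2 + b * x ^+ q.+1 + r) 1]].

(* Classical unitals are the nondegenerate Hermitian curves: the sets of      *)
(* absolute points of a unitary polarity, given by a Hermitian matrix H.      *)
Definition conj_mx (F : finFieldType) (q m n : nat) (A : 'M[F]_(m, n)) :
  'M[F]_(m, n) := map_mx (fun t => t ^+ q) A.

Definition classical (F : finFieldType) (q : nat) (U : {pred point F}) : Prop :=
  exists H : 'M[F]_3,
    [/\ H \in unitmx, H^T = conj_mx q H &
        forall (P : point F) (v : 'rV[F]_3), val P = <[v]>%VS ->
          (P \in U) = (v *m H *m (conj_mx q v)^T == 0)].

Definition conic_unital (F : finFieldType) (q : nat) (U : {pred point F}) :
  Prop :=
  exists a : F,
    [/\ BM_parameters q a 0, ~ classical q (BM_unital q a 0) &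
        equivalent U (BM_unital q a 0)].

Definition quadrangle (F : fieldType) (A B C D : point F) : Prop :=
  uniq [:: A; B; C; D] /\
  [/\ ~ collinear A B C, ~ collinear A B D, ~ collinear A C D &
      ~ collinear B C D].

(* For P <> Q and R <> S, val P + val Q is the line PQ and val R + val S is   *)
(* the line RS.                                                               *)
Definition joins_meet_in (F : fieldType) (U : {pred point F})
  (P Q R S : point F) : Prop :=
  exists X : point F,
    [/\ X \in U, (val X <= val P + val Q)%VS & (val X <= val R + val S)%VS].

Definition triple_ONan (F : fieldType) (U : {pred point F})
  (T : {pred line F}) : Prop :=
  exists A B C D : point F,
    [/\ [/\ A \in U, B \in U, C \in U & D \in U],
        quadrangle A B C D,
        [/\ joins_meet_in U A B C D, joins_meet_in U A C B D &
            joins_meet_in U A D B C] &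
        forall L : line F,
          (L \in T) <->
          (exists P Q : point F,
             [/\ P \in [:: A; B; C; D], Q \in [:: A; B; C; D], P != Q,
                 incident P L & incident Q L])].

Definition BM_special (F : fieldType) (T : {pred line F}) : Prop :=
  exists2 L : line F, L \in T & incident (T_infty F) L.

(* Main.v *)
(* Put conj t = t^q and Im t = t - conj t. The affine points of U_{a,b} are    *)
(* the (x, y) with Im y = Q(x), where Q(x) = Im(a x^2 + b x conj x) is an       *)
(* anisotropic quadratic form over F_q. Hence no O'Nan configuration (four      *)
(* lines meeting in six points of the unital) passes through T_infty, so a      *)
(* BM-special line joins two vertices A, B that are affine, together with the   *)
(* diagonal point on AB. Normalizing that line to x = 0, the configuration      *)
(* becomes                                                                      *)
(*   A = (0, l - k, 1), B = (0, l + k, 1), AB.CD = (0, 0, 1),                   *)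
(*   C = (X, Y, s - k), D = (X, Y, s + k),                                      *)
(*   AC.BD = (X, Y + l^2 - k^2, s + l), AD.BC = (X, Y - l^2 + k^2, s - l)       *)
(* with k, l in F_q^* and k^2 <> l^2, and all its points lie on U_{a,b} for     *)
(* some Y exactly when w = a X^2 / ((s^2 - k^2)(s^2 - l^2)) satisfies           *)
(* Tr(w s) = 0 and l Tr w = -1. So b is irrelevant, and the configuration       *)
(* exists iff a eps s (s^2 - k^2)(s^2 - l^2) is a square for some s outside     *)
(* F_q, where conj eps = - eps. For q >= 7, choose s so that a eps s is a       *)
(* square; two of the three values of s^2 - c^2, c = 1, h, h^2 (h a generator   *)
(* of F_q^* ), have the same quadratic character. For q = 5 the product is      *)
(* s^5 - s = - Im s, so a must be a square; for q = 3 no k, l exist. Finally    *)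
(* every affine point does lie on an O'Nan configuration, so equivalences       *)
(* between these unitals fix T_infty.                                           *)

(* After clearing denominators ([affine_unital_div]), membership of C, D, AC.BD and AD.BC in the
   unital becomes four equations in which Y occurs only through Im Y and Y conj s - s conj Y. Since
   1 and s form a basis over F_q, these are two arbitrary purely imaginary unknowns. Eliminating
   them leaves the two trace conditions on w, with b absorbed into the unknowns ([triple_equations];
   [triple_equations_nec] is the part of the converse that small q needs). The choice w = r eps / s
   with r in F_q satisfies both conditions. Solving for X then asks for a square of F, and factors
   from F_q are squares there: this is [triple_quad_of_chi], whose criterion is met by a pigeonhole
   argument in [triple_quad_exists_ge7] and by explicit values in [triple_quad_exists_5].

   For q = 3 or 5, [small_triple_quad_chi] shows that a BM-special configuration forces the
   coefficient of x^2 to be a square, while in U_{c,0} a square c would make the discriminant 4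
   c^(q+1) a square of F_q. To pass from U_{c,0} to an equivalent unital, T_infty is recognized as
   the only point of the unital on no O'Nan configuration ([no_ONan_through_T_infty],
   [ONan_through_affine_point]). When Im b is nonzero, [small_nonconic_chi] rules out q = 3 and
   makes a a square for q = 5. *)
Require Import Defs.
From mathcomp Require Import all_boot all_order all_algebra all_field.
From mathcomp Require Import ring zify.

Set Implicit Arguments.
Unset Strict Implicit.
Unset Printing Implicit Defensive.

Import GRing.Theory.
Local Open Scope ring_scope.

(** * Points, lines and collinearity in homogeneous coordinates *)

Section Plane.
Variable F : fieldType.
Implicit Types (P Q R S : point F) (L : line F) (x y z : F).

Lemma vec3D x y z x' y' z' :
  vec3 x y z + vec3 x' y' z' = vec3 (x + x') (y + y') (z + z').
Proof. by apply/rowP=> -[[|[|[|m]]] lt]; rewrite !mxE. Qed.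

Lemma vec3Z k x y z : k *: vec3 x y z = vec3 (k * x) (k * y) (k * z).
Proof. by apply/rowP=> -[[|[|[|m]]] lt]; rewrite !mxE. Qed.

Lemma vec3_inj x y z x' y' z' :
  vec3 x y z = vec3 x' y' z' -> [/\ x = x', y = y' & z = z'].
Proof.
move=> /rowP e; split.
- by have := e 0; rewrite ?mxE.
- by have := e 1; rewrite ?mxE.
- by have := e (inord 2); rewrite !mxE inordK.
Qed.

Lemma vec3_coords (v : 'rV[F]_3) : v = vec3 (v 0 0) (v 0 1) (v 0 (inord 2)).
Proof.
by apply/rowP=> -[[|[|[|m]]] lt] //; rewrite !mxE /=; congr (v _ _); apply/val_inj;
  rewrite //= inordK.
Qed.

Lemma vec3_eq0 x y z : (vec3 x y z == 0) = [&& x == 0, y == 0 & z == 0].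
Proof.
apply/eqP/and3P => [e | [/eqP-> /eqP-> /eqP->]].
  by split; apply/eqP; [have /rowP/(_ 0) := e | have /rowP/(_ 1) := e
    | have /rowP/(_ (inord 2)) := e]; rewrite !mxE ?inordK.
by apply/rowP=> -[[|[|[|m]]] lt]; rewrite ?mxE.
Qed.

Lemma has_coords_neq0 P x y z : has_coords P x y z -> vec3 x y z != 0.
Proof.
by move=> /eqP e; have := valP P; rewrite e dim_vline; case: (_ == 0).
Qed.

Lemma point_of_coords x y z :
  vec3 x y z != 0 -> exists P, has_coords P x y z.
Proof.
move=> nz; have d1 : \dim <[vec3 x y z]> == 1%N by rewrite dim_vline nz.
by exists (Sub <[vec3 x y z]>%VS d1); rewrite /has_coords.
Qed.

Lemma has_coordsZ P x y z k : k != 0 ->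
  has_coords P x y z -> has_coords P (k * x) (k * y) (k * z).
Proof.
move=> nzk hP; rewrite /has_coords (eqP hP) -vec3Z eqEdim -memvE.
rewrite !dim_vline scaler_eq0 (negPf nzk) leqnn andbT.
by rewrite -[X in X \in _](scalerK nzk) memvZ ?memv_line.
Qed.

Lemma has_coords_inj P Q x y z :
  has_coords P x y z -> has_coords Q x y z -> P = Q.
Proof. by move=> /eqP hP /eqP hQ; apply/val_inj; rewrite hP hQ. Qed.

Lemma eq_point_coords P x y z x' y' z' :
  has_coords P x y z -> has_coords P x' y' z' ->
  exists k, [/\ x = k * x', y = k * y' & z = k * z'].
Proof.
move=> /eqP hP /eqP; rewrite hP => e.
have : vec3 x y z \in <[vec3 x' y' z']>%VS by rewrite -e memv_line.
by case/vlineP=> k; rewrite vec3Z => /vec3_inj ?; exists k.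
Qed.

Lemma neq_affine P Q x y x' y' :
  has_coords P x y 1 -> has_coords Q x' y' 1 ->
  P != Q -> (x != x') || (y != y').
Proof.
move=> hP hQ; apply: contraR; rewrite negb_or !negbK => /andP[/eqP ex /eqP ey].
by apply/eqP; move: hQ; rewrite -ex -ey; apply: has_coords_inj.
Qed.

Lemma dim_join P Q : P != Q -> \dim (val P + val Q)%VS = 2%N.
Proof.
move=> neqPQ; have := dimv_sum_cap (val P) (val Q).
rewrite (eqP (valP P)) (eqP (valP Q)).
suff /eqP-> : \dim (val P :&: val Q)%VS == 0%N by rewrite addn0.
have := dimvS (capvSl (val P) (val Q)); rewrite (eqP (valP P)).
case d : (\dim _) => [|[|//]] // _; case/eqP: neqPQ; apply/val_inj => /=.
have /eqP <- : (val P :&: val Q)%VS == val P.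
  by rewrite eqEdim capvSl d (eqP (valP P)).
by apply/eqP; rewrite eqEdim capvSr d (eqP (valP Q)).
Qed.

Lemma join_line P Q L : P != Q -> incident P L -> incident Q L ->
  val L = (val P + val Q)%VS.
Proof.
move=> neqPQ iP iQ; apply/esym/eqP; rewrite eqEdim dim_join // (eqP (valP L)).
by rewrite leqnn andbT subv_add; apply/andP.
Qed.

Lemma collinearP P Q R : P != Q ->
  collinear P Q R <-> (val R <= val P + val Q)%VS.
Proof.
move=> neqPQ; split=> [[L [iP iQ iR]] | sub].
  by rewrite -(join_line neqPQ iP iQ).
have dL : \dim (val P + val Q)%VS == 2%N by rewrite dim_join.
by exists (Sub (val P + val Q)%VS dL); rewrite /incident /= addvSl addvSr.
Qed.

Lemma collinear_coords P Q R x1 y1 z1 x2 y2 z2 x3 y3 z3 : P != Q ->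
    has_coords P x1 y1 z1 -> has_coords Q x2 y2 z2 -> has_coords R x3 y3 z3 ->
  collinear P Q R <->
  exists s t, [/\ x3 = s * x1 + t * x2, y3 = s * y1 + t * y2
                & z3 = s * z1 + t * z2].
Proof.
move=> neqPQ /eqP hP /eqP hQ /eqP hR.
rewrite collinearP // hP hQ hR -memvE; split.
  case/memv_addP=> u /vlineP[s ->] [v /vlineP[t ->]].
  by rewrite !vec3Z vec3D => /vec3_inj e; exists s, t.
case=> s [t [-> -> ->]]; rewrite -vec3D -!vec3Z.
by rewrite memv_add ?memvZ ?memv_line.
Qed.

Lemma collinearCA P Q R : collinear P Q R -> collinear Q R P.
Proof. by case=> L [*]; exists L. Qed.

Lemma collinearC P Q R : collinear P Q R -> collinear Q P R.
Proof. by case=> L [*]; exists L. Qed.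

Lemma collinearAC P Q R : collinear P Q R -> collinear P R Q.
Proof. by case=> L [*]; exists L. Qed.

Lemma collinear_trans P Q R S : P != Q ->
  collinear P Q R -> collinear P Q S -> collinear P R S.
Proof.
move=> neqPQ [L [iP iQ iR]] [M [jP jQ jS]]; exists L; split=> //.
by rewrite /incident (join_line neqPQ iP iQ) -(join_line neqPQ jP jQ).
Qed.

Lemma collinear_refl P Q : collinear P P Q.
Proof.
have aux R S : R != S -> collinear R R S.
  by move=> ne; case: (iffRL (collinearP R ne) (addvSl _ _)) => L [*]; exists L.
have [eqPQ|] := eqVneq P Q; last exact: aux.
have [S neS] : exists S, S != P.
  have [|T hT] := @point_of_coords 1 0 0.
    by rewrite vec3_eq0 oner_eq0.
  have hI : has_coords (T_infty F) 0 1 0 by rewrite /has_coords.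
  case: (eqVneq T P) => [eTP|]; last by exists T.
  exists (T_infty F); rewrite -eTP; apply/eqP => e; rewrite e in hI.
  have [k [/esym/eqP + e1 _]] := eq_point_coords hI hT.
  rewrite mulr1 => /eqP ek; move: e1; rewrite ek mul0r => /eqP.
  by rewrite oner_eq0.
have [L [iP _ _]] : collinear P P S by apply: aux; rewrite eq_sym.
by exists L; rewrite -eqPQ.
Qed.

Lemma noncollinear_neq P Q R : ~ collinear P Q R ->
  [/\ P != Q, P != R & Q != R].
Proof.
move=> nc; split; apply/eqP=> e; apply: nc; rewrite e.
- exact: collinear_refl.
- apply/collinearC/collinearCA/collinearCA; exact: collinear_refl.
- apply/collinearCA/collinearCA; exact: collinear_refl.
Qed.

Lemma has_coords_T_infty : has_coords (T_infty F) 0 1 0.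
Proof. by rewrite /has_coords. Qed.

End Plane.

(** * The equation of the unital over a field with an involution *)

Section Algebra.
Variables (F : fieldType) (phi : {rmorphism F -> F}).
Hypothesis phiK : involutive phi.
Hypothesis two_neq0 : (2 : F) != 0.
Implicit Types a b x y z : F.

Let phiE := (rmorphB, rmorphD, rmorphM, rmorphN, fmorphV, rmorphXn, rmorph1,
  rmorph0, rmorph_nat, phiK).

Definition imag x := x - phi x.

Definition affine_unital a b x y :=
  imag y == imag (a * x ^+ 2 + b * (x * phi x)).

Definition anisotropic a b :=
  forall x, imag (a * x ^+ 2 + b * (x * phi x)) = 0 -> x = 0.

(** A zero x <> 0 gives a root u = phi x / x of phi a u^2 - imag b u - a = 0. Then 2 phi a u - imag
    b is fixed by [phi] and is a square root of the discriminant. *)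
Lemma nonsquare_anisotropic a b :
  (forall t, phi t = t -> t ^+ 2 <> imag b ^+ 2 + 4%:R * (a * phi a)) ->
  anisotropic a b.
Proof.
move=> nsq x e; apply/eqP/negPn/negP => nz.
have nz' : phi x != 0 by rewrite fmorph_eq0.
apply: (nsq (2%:R * phi a * phi x / x - imag b)).
  apply/eqP; rewrite -subr_eq0; apply/eqP.
  transitivity (2%:R * imag (a * x ^+ 2 + b * (x * phi x)) / (x * phi x)).
    by rewrite /imag !phiE; field; rewrite ?nz ?nz'.
  by rewrite e mulr0 mul0r.
apply/eqP; rewrite -subr_eq0; apply/eqP.
transitivity (-4%:R * phi a * imag (a * x ^+ 2 + b * (x * phi x)) / x ^+ 2).
  by rewrite /imag !phiE; field; rewrite ?nz ?nz'.
by rewrite e mulr0 mul0r.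
Qed.


(** Lets [ring] prove an equation as a linear combination of hypotheses, the combination being
    assembled with [congr1] and [congr2]. *)
Lemma eq_lincomb u v x y : u = v -> x - y = u - v -> x = y.
Proof. by move=> -> /eqP; rewrite subrr subr_eq0 => /eqP. Qed.

Lemma phi_eq_imag x y : imag x = imag y -> phi (x - y) = x - y.
Proof.
move=> e; apply/eqP; rewrite eq_sym -subr_eq0; apply/eqP.
transitivity (imag x - imag y); first by rewrite /imag !phiE; ring.
by rewrite e subrr.
Qed.

(** Both oblique lines reach x with the same weight s, and their meeting gives s r + (1 - s) r' = 0,
    where r and r' are the differences of y on the two vertical lines. These are fixed by [phi],
    hence so is s. With Q the quadratic form on the right of the unital equation, s Q(x1) + (1 - s)
    Q(x2) - Q(x) = s (1 - s) Q(x1 - x2) must vanish, against anisotropy. *)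
Lemma affine_no_ONan a b x1 y1 y2 x2 z1 z2 x y s t s' t' :
    anisotropic a b ->
    affine_unital a b x1 y1 -> affine_unital a b x1 y2 ->
    affine_unital a b x2 z1 -> affine_unital a b x2 z2 ->
    affine_unital a b x y ->
    x1 != x2 -> y1 != y2 -> z1 != z2 ->
    [/\ x = s * x1 + t * x2, y = s * y1 + t * z1 & 1 = s + t] ->
    [/\ x = s' * x1 + t' * x2, y = s' * y2 + t' * z2 & 1 = s' + t'] ->
  False.
Proof.
move=> aniso /eqP u1 /eqP u2 /eqP v1 /eqP v2 /eqP u nx ny nz [ex ey e1] [ex' ey' e1'].
have et : t = 1 - s by rewrite e1; ring.
have et' : t' = 1 - s' by rewrite e1'; ring.
have es : s' = s.
  have : (s' - s) * (x1 - x2) = 0.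
    rewrite (_ : _ * _ = (s' * x1 + t' * x2) - (s * x1 + t * x2)) ?et ?et'; last by ring.
    by rewrite -et -et' -ex -ex' subrr.
  by move/eqP; rewrite mulf_eq0 !subr_eq0 (negPf nx) orbF => /eqP.
have er : phi (y1 - y2) = y1 - y2 by apply: phi_eq_imag; rewrite u1 u2.
have er' : phi (z1 - z2) = z1 - z2 by apply: phi_eq_imag; rewrite v1 v2.
have r0 : y1 - y2 != 0 by rewrite subr_eq0.
have r0' : z1 - z2 != 0 by rewrite subr_eq0.
have esr : s * (y1 - y2) + (1 - s) * (z1 - z2) = 0.
  transitivity ((s * y1 + t * z1) - (s' * y2 + t' * z2)); last by rewrite -ey -ey' subrr.
  by rewrite et et' es; ring.
have esD : s * (z1 - z2 - (y1 - y2)) = z1 - z2.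
  by apply/eqP; rewrite -subr_eq0 -oppr_eq0 -esr; apply/eqP; ring.
have s0 : s != 0 by apply: contra r0' => /eqP e; rewrite -esD e mul0r.
have t0 : 1 - s != 0.
  by apply: contra r0 => /eqP e; move/eqP: esr; rewrite e mul0r addr0 mulf_eq0 (negPf s0).
have D0 : z1 - z2 - (y1 - y2) != 0 by apply: contra r0' => /eqP e; rewrite -esD e mulr0.
have eqs : phi s = s.
  have -> : s = (z1 - z2) / (z1 - z2 - (y1 - y2)) by rewrite -{1}esD mulfK.
  by rewrite rmorphM fmorphV (rmorphB phi (z1 - z2)) er er'.
case/eqP: nx; apply/eqP; rewrite -subr_eq0; apply/eqP/aniso.
apply/eqP; rewrite -(mulrI_eq0 _ (mulfI s0)) -(mulrI_eq0 _ (mulfI t0)); apply/eqP.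
transitivity (s * (imag (a * x1 ^+ 2 + b * (x1 * phi x1)) - imag y1)
  + (1 - s) * (imag (a * x2 ^+ 2 + b * (x2 * phi x2)) - imag z1)
  - (imag (a * x ^+ 2 + b * (x * phi x)) - imag y)).
  by rewrite ex ey et /imag !phiE eqs; ring.
by rewrite -u1 -v1 -u; ring.
Qed.

(** The coefficient of x absorbs the polar form of the quadratic form at x0. These collineations
    send the origin to any affine point of the unital, so configurations may be normalized there. *)
Lemma affine_unital_shear a b x0 y0 x y : affine_unital a b x0 y0 ->
  affine_unital a b (x + x0) (y + (2%:R * a * x0 + imag b * phi x0) * x + y0) =
  affine_unital a b x y.
Proof.
move=> /eqP u; rewrite /affine_unital -subr_eq0 -[RHS]subr_eq0; congr (_ == 0).
transitivity (imag y - imag (a * x ^+ 2 + b * (x * phi x))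
  + (imag y0 - imag (a * x0 ^+ 2 + b * (x0 * phi x0)))).
  by rewrite /imag !phiE; ring.
by rewrite u subrr addr0.
Qed.

(** In this form y occurs only on the left. For z = s + c with c fixed by [phi], the factor [imag z]
    does not depend on c, so points with such denominators can be compared. *)
Lemma affine_unital_div a b x y z : z != 0 ->
  affine_unital a b (x / z) (y / z) =
  (y * phi z - phi y * z == imag (a * x ^+ 2) + imag b * (x * phi x)
    - imag z * (a * x ^+ 2 / z + phi (a * x ^+ 2 / z))).
Proof.
move=> nz; have nz' : phi z != 0 by rewrite fmorph_eq0.
have nzz : z * phi z != 0 by rewrite mulf_neq0.
rewrite /affine_unital -subr_eq0 -[RHS]subr_eq0 -(mulrI_eq0 _ (mulfI nzz)).
by congr (_ == 0); rewrite /imag !phiE; field; rewrite nz nz'.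
Qed.

Lemma imag_neq0_add s k : phi k = k -> imag s != 0 -> s + k != 0.
Proof.
move=> ek; apply: contra => /eqP e.
have <- : imag (s + k) = imag s by rewrite /imag !phiE ek; ring.
by rewrite e /imag rmorph0 subrr.
Qed.

(** Cramer's rule for y and phi y, with determinant [imag s] up to sign. *)
Lemma imag_system s v u : imag s != 0 -> phi v = - v -> phi u = - u ->
  exists y, imag y = v /\ y * phi s - phi y * s = u.
Proof.
rewrite /imag => ns ev eu; exists ((v * s - u) / (s - phi s)).
have ns' : phi s - s != 0 by rewrite -opprB oppr_eq0.
by rewrite !phiE ev eu; split; field; rewrite ns ns'.
Qed.

(** With g = a x^2 / (s + c), the point with denominator s + c and shift m asks that Tr g be an
    affine function of c plus m. Expanding g in powers of s and using both trace hypotheses gives Tr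
    g = tr3 - c (tr2 + l) + m for c = k, -k, l, -l. [imag_system] then yields one y serving all four
    values. *)
Lemma triple_equations a b s k l w x :
    imag s != 0 -> phi k = k -> phi l = l ->
    w * s + phi (w * s) = 0 -> l * (w + phi w) = -1 ->
    a * x ^+ 2 = w * (s ^+ 2 - k ^+ 2) * (s ^+ 2 - l ^+ 2) ->
  exists y, [/\ affine_unital a b (x / (s - k)) (y / (s - k)),
    affine_unital a b (x / (s + k)) (y / (s + k)),
    affine_unital a b (x / (s + l)) ((y + (l ^+ 2 - k ^+ 2)) / (s + l)) &
    affine_unital a b (x / (s - l)) ((y - (l ^+ 2 - k ^+ 2)) / (s - l))].
Proof.
move=> ns ek el; rewrite rmorphM => ews ew ea.
have [tr2 e2] : exists t, t = w * s ^+ 2 + phi w * phi s ^+ 2 by eexists.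
have [tr3 e3] : exists t, t = w * s ^+ 3 + phi w * phi s ^+ 3 by eexists.
have etr2 : phi tr2 = tr2 by rewrite e2 !phiE; ring.
have etr3 : phi tr3 = tr3 by rewrite e3 !phiE; ring.
have [||y [eV eW]] := @imag_system s (imag s * (tr2 + l))
    (imag (a * x ^+ 2) + imag b * (x * phi x) - imag s * tr3) ns.
- by rewrite /imag !phiE etr2 el; ring.
- by rewrite /imag !phiE etr3; ring.
have ek' : phi (- k) = - k by rewrite rmorphN ek.
have el' : phi (- l) = - l by rewrite rmorphN el.
have em : phi (l ^+ 2 - k ^+ 2) = l ^+ 2 - k ^+ 2 by rewrite !phiE ek el.
have aux c m g : phi c = c -> phi m = m ->
    w * (s ^+ 2 - k ^+ 2) * (s ^+ 2 - l ^+ 2) = g * (s + c) ->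
    g + phi g = tr3 - c * (tr2 + l) + m ->
    affine_unital a b (x / (s + c)) ((y + m) / (s + c)).
  move=> ec em' eg h; have nz := imag_neq0_add ec ns.
  have egc : a * x ^+ 2 / (s + c) = g by rewrite ea eg mulfK.
  rewrite affine_unital_div // egc h.
  have -> : imag (s + c) = imag s by rewrite /imag !phiE ec; ring.
  rewrite -subr_eq0; apply/eqP.
  transitivity (y * phi s - phi y * s + c * imag y - m * imag s
     - (imag (a * x ^+ 2) + imag b * (x * phi x) - imag s * (tr3 - c * (tr2 + l) + m))).
    by rewrite /imag !phiE ec em'; ring.
  by rewrite eV eW; ring.
exists y; split.
- rewrite -[y]addr0; apply: (aux (- k) 0 (w * (s + k) * (s ^+ 2 - l ^+ 2))) => //.
  + by rewrite rmorph0.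
  + by ring.
  + apply/eqP; rewrite -subr_eq0; apply/eqP.
    transitivity (- l ^+ 2 * (w * s + phi w * phi s)
       - k * l * (l * (w + phi w) - -1)).
      by rewrite e2 e3 !phiE ek el; ring.
    by rewrite ew ews; ring.
- rewrite -[y]addr0; apply: (aux k 0 (w * (s - k) * (s ^+ 2 - l ^+ 2))) => //.
  + by rewrite rmorph0.
  + by ring.
  + apply/eqP; rewrite -subr_eq0; apply/eqP.
    transitivity (- l ^+ 2 * (w * s + phi w * phi s)
       + k * l * (l * (w + phi w) - -1)).
      by rewrite e2 e3 !phiE ek el; ring.
    by rewrite ew ews; ring.
- apply: (aux l (l ^+ 2 - k ^+ 2) (w * (s - l) * (s ^+ 2 - k ^+ 2))) => //.
  + by ring.
  + apply/eqP; rewrite -subr_eq0; apply/eqP.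
    transitivity (- k ^+ 2 * (w * s + phi w * phi s)
       + k ^+ 2 * (l * (w + phi w) - -1)).
      by rewrite e2 e3 !phiE ek el; ring.
    by rewrite ew ews; ring.
- rewrite -[l ^+ 2 - k ^+ 2]opprK opprK.
  apply: (aux (- l) (- (l ^+ 2 - k ^+ 2)) (w * (s + l) * (s ^+ 2 - k ^+ 2))) => //.
  + by rewrite rmorphN em.
  + by ring.
  + apply/eqP; rewrite -subr_eq0; apply/eqP.
    transitivity (- k ^+ 2 * (w * s + phi w * phi s)
       - k ^+ 2 * (l * (w + phi w) - -1)).
      by rewrite e2 e3 !phiE ek el; ring.
    by rewrite ew ews; ring.
Qed.

(** The same elimination with c = -1, 1, 0. Three equations in two unknowns leave only one condition
    on w, which is why O'Nan configurations are easier to obtain. *)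
Lemma ONan_equations a b s w x :
    imag s != 0 -> w + phi w = -1 ->
    a * x ^+ 2 = w * s * (s ^+ 2 - 1) ->
  exists y, [/\ affine_unital a b (x / (s - 1)) (y / (s - 1)),
    affine_unital a b (x / (s + 1)) (y / (s + 1)) &
    affine_unital a b (x / s) ((y + 1) / s)].
Proof.
move=> ns ew ea.
have [tr1 e1] : exists t, t = w * s + phi w * phi s by eexists.
have [tr2 e2] : exists t, t = w * s ^+ 2 + phi w * phi s ^+ 2 by eexists.
have etr1 : phi tr1 = tr1 by rewrite e1 !phiE; ring.
have etr2 : phi tr2 = tr2 by rewrite e2 !phiE; ring.
have [||y [eV eW]] := @imag_system s (imag s * tr1)
    (imag (a * x ^+ 2) + imag b * (x * phi x) - imag s * tr2) ns.
- by rewrite /imag !phiE etr1; ring.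
- by rewrite /imag !phiE etr2; ring.
have aux c m g : phi c = c -> phi m = m ->
    w * s * (s ^+ 2 - 1) = g * (s + c) ->
    g + phi g = tr2 - c * tr1 + m ->
    affine_unital a b (x / (s + c)) ((y + m) / (s + c)).
  move=> ec em' eg h; have nz := imag_neq0_add ec ns.
  have egc : a * x ^+ 2 / (s + c) = g by rewrite ea eg mulfK.
  rewrite affine_unital_div // egc h.
  have -> : imag (s + c) = imag s by rewrite /imag !phiE ec; ring.
  rewrite -subr_eq0; apply/eqP.
  transitivity (y * phi s - phi y * s + c * imag y - m * imag s
     - (imag (a * x ^+ 2) + imag b * (x * phi x) - imag s * (tr2 - c * tr1 + m))).
    by rewrite /imag !phiE ec em'; ring.
  by rewrite eV eW; ring.
exists y; split.
- rewrite -[y]addr0; apply: (aux (- 1) 0 (w * s * (s + 1))) => //.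
  + by rewrite !phiE.
  + by rewrite rmorph0.
  + by ring.
  + by rewrite e1 e2 !phiE; ring.
- rewrite -[y]addr0; apply: (aux 1 0 (w * s * (s - 1))) => //.
  + by rewrite !phiE.
  + by rewrite rmorph0.
  + by ring.
  + by rewrite e1 e2 !phiE; ring.
- have h := aux 0 1 (w * (s ^+ 2 - 1)); rewrite !addr0 in h; apply: h => //.
  + by rewrite rmorph0.
  + by rewrite rmorph1.
  + by ring.
  + transitivity (tr2 - (w + phi w)); first by rewrite e2 !phiE; ring.
    by rewrite ew; ring.
Qed.

(** Adding the equations for k and -k and subtracting those for l and -l eliminates y and leaves 2
    imag s (k^2 - l^2) Tr(w s) = 0. If l = 0, the last two equations differ only in the shifts k^2
    and -k^2, which forces k = 0. *)
Lemma triple_equations_nec a b s k l x y :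
    imag s != 0 -> phi k = k -> phi l = l -> k != 0 -> k ^+ 2 != l ^+ 2 ->
    affine_unital a b (x / (s - k)) (y / (s - k)) ->
    affine_unital a b (x / (s + k)) (y / (s + k)) ->
    affine_unital a b (x / (s + l)) ((y + (l ^+ 2 - k ^+ 2)) / (s + l)) ->
    affine_unital a b (x / (s - l)) ((y - (l ^+ 2 - k ^+ 2)) / (s - l)) ->
  l != 0 /\ let w := a * x ^+ 2 / ((s ^+ 2 - k ^+ 2) * (s ^+ 2 - l ^+ 2)) in
    w * s + phi (w * s) = 0.
Proof.
move=> ns ek el nk nkl.
have ek' : phi (- k) = - k by rewrite rmorphN ek.
have el' : phi (- l) = - l by rewrite rmorphN el.
have n1 := imag_neq0_add ek ns; have n2 := imag_neq0_add ek' ns.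
have n3 := imag_neq0_add el ns; have n4 := imag_neq0_add el' ns.
have n5 : s ^+ 2 - k ^+ 2 != 0 by rewrite subr_sqr mulf_neq0.
have n6 : s ^+ 2 - l ^+ 2 != 0 by rewrite subr_sqr mulf_neq0.
have n7 : k ^+ 2 - l ^+ 2 != 0 by rewrite subr_eq0.
have [w ew] : exists w, a * x ^+ 2 = w * (s ^+ 2 - k ^+ 2) * (s ^+ 2 - l ^+ 2).
  by exists (a * x ^+ 2 / ((s ^+ 2 - k ^+ 2) * (s ^+ 2 - l ^+ 2))); field; rewrite n5 n6.
rewrite /= ew -(mulrA w) mulfK ?mulf_neq0 //.
have [K eK] : exists K, K = imag (a * x ^+ 2) + imag b * (x * phi x) by eexists.
have aux c m g : phi c = c -> phi m = m ->
    w * (s ^+ 2 - k ^+ 2) * (s ^+ 2 - l ^+ 2) = g * (s + c) ->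
    affine_unital a b (x / (s + c)) ((y + m) / (s + c)) ->
  y * phi s - phi y * s + c * imag y - m * imag s = K - imag s * (g + phi g).
  move=> ec em eg; have nz := imag_neq0_add ec ns.
  have egc : a * x ^+ 2 / (s + c) = g by rewrite ew eg mulfK.
  rewrite affine_unital_div // -eK egc => /eqP.
  have -> : imag (s + c) = imag s by rewrite /imag !phiE ec; ring.
  by move=> <-; rewrite /imag !phiE ec em; ring.
rewrite -{1 2}[y]addr0 => u1 u2 u3 u4.
have em : phi (l ^+ 2 - k ^+ 2) = l ^+ 2 - k ^+ 2 by rewrite !phiE ek el.
have {}u1 := aux (- k) 0 (w * (s + k) * (s ^+ 2 - l ^+ 2)) ek' (rmorph0 _) _ u1.
have {}u2 := aux k 0 (w * (s - k) * (s ^+ 2 - l ^+ 2)) ek (rmorph0 _) _ u2.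
have {}u3 := aux l _ (w * (s - l) * (s ^+ 2 - k ^+ 2)) el em _ u3.
have {}u4 := aux (- l) (- (l ^+ 2 - k ^+ 2)) (w * (s + l) * (s ^+ 2 - k ^+ 2)) el' _ _ u4.
have /= {}u1 := u1 ltac:(ring); have /= {}u2 := u2 ltac:(ring).
have /= {}u3 := u3 ltac:(ring); have /= {}u4 := u4 ltac:(by rewrite rmorphN em) ltac:(ring).
split.
  apply: contraNneq (nk) => l0; rewrite l0 in u3 u4 *.
  have nz : 2%:R * k * imag s != 0 by rewrite !mulf_neq0.
  apply/eqP; apply: (mulfI nz); apply: (eq_lincomb (congr2 (fun p r => p - r) u3 u4)).
  by rewrite !phiE; ring.
have nz : 2%:R * imag s * (k ^+ 2 - l ^+ 2) != 0 by rewrite !mulf_neq0.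
apply: (mulfI nz); apply: (eq_lincomb
  (congr2 (fun p r => p - r) (congr2 +%R u1 u2) (congr2 +%R u3 u4))).
by rewrite !phiE ek el; ring.
Qed.
End Algebra.

(** * Collinearity in affine coordinates *)

Section AffinePoints.
Variable F : fieldType.
Implicit Types (P Q R : point F) (x y : F).

Lemma affine_neq_T_infty P x y : has_coords P x y 1 -> P != T_infty F.
Proof.
move=> hP; apply/eqP=> e; have hT := has_coords_T_infty F; rewrite -e in hT.
have [k [_ _ /eqP]] := eq_point_coords hP hT.
by rewrite mulr0 oner_eq0.
Qed.

Lemma affine_coords_inj P x y x' y' :
  has_coords P x y 1 -> has_coords P x' y' 1 -> x = x' /\ y = y'.
Proof.
move=> h h'; have [k [-> ->]] := eq_point_coords h h'.
by rewrite mulr1 => <-; rewrite !mul1r.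
Qed.

Lemma affine_point_exists x y : exists P, has_coords P x y 1.
Proof. by apply: point_of_coords; rewrite vec3_eq0 oner_eq0 !andbF. Qed.

(** The determinant form covers vertical lines and coincident points uniformly. *)
Lemma collinear_affine P Q R x1 y1 x2 y2 x3 y3 :
    has_coords P x1 y1 1 -> has_coords Q x2 y2 1 -> has_coords R x3 y3 1 ->
  collinear P Q R <-> (x2 - x1) * (y3 - y1) = (x3 - x1) * (y2 - y1).
Proof.
move=> hP hQ hR; have [ePQ|ne] := eqVneq P Q.
  rewrite -ePQ in hQ *; have [-> ->] := affine_coords_inj hP hQ.
  by rewrite !subrr mul0r mulr0; split=> // _; apply: collinear_refl.
rewrite (collinear_coords ne hP hQ hR); split.
  case=> s [t [-> ->]]; rewrite !mulr1 => e1.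
  have -> : s = 1 - t by rewrite e1; ring.
  by ring.
move=> e; have := neq_affine hP hQ ne; have [ex /= ny | nx _] := eqVneq x1 x2.
  have n : y2 - y1 != 0 by rewrite subr_eq0 eq_sym.
  exists (1 - (y3 - y1) / (y2 - y1)), ((y3 - y1) / (y2 - y1)); split.
  - apply/eqP; rewrite -ex -subr_eq0 -(mulIr_eq0 _ (mulIf n)); apply/eqP.
    transitivity ((x3 - x1) * (y2 - y1)); first by field.
    by rewrite -e ex subrr mul0r.
  - by field.
  - by ring.
have n : x2 - x1 != 0 by rewrite subr_eq0 eq_sym.
exists (1 - (x3 - x1) / (x2 - x1)), ((x3 - x1) / (x2 - x1)); split.
- by field.
- apply/eqP; rewrite -subr_eq0 -(mulIr_eq0 _ (mulIf n)); apply/eqP.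
  transitivity ((x2 - x1) * (y3 - y1) - (x3 - x1) * (y2 - y1)); first by field.
  by rewrite e subrr.
- by ring.
Qed.

Lemma collinear_T_infty P Q x1 y1 x2 y2 :
    has_coords P x1 y1 1 -> has_coords Q x2 y2 1 ->
  collinear (T_infty F) P Q <-> x1 = x2.
Proof.
move=> hP hQ; have ne := affine_neq_T_infty hP; rewrite eq_sym in ne.
rewrite (collinear_coords ne (has_coords_T_infty F) hP hQ); split.
  by case=> s [t [-> _]]; rewrite !mulr0 !mulr1 !add0r => <-; rewrite mul1r.
by move=> ->; exists (y2 - y1), 1; split; ring.
Qed.


(* In coordinates where the diagonal point on the vertical line AB is the     *)
(* origin, the slopes of the remaining lines determine the parameter [s].     *)
Lemma triple_parametrization (al be x1 y1 x2 y2 x3 y3 x4 y4 : F) :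
    (2 : F) != 0 -> al != be -> x1 != 0 -> x2 != 0 -> x1 != x2 ->
    x1 * y2 = x2 * y1 ->
    x1 * (y3 - al) = x3 * (y1 - al) -> x2 * (y3 - be) = x3 * (y2 - be) ->
    x2 * (y4 - al) = x4 * (y2 - al) -> x1 * (y4 - be) = x4 * (y1 - be) ->
  exists s x y, let k := (be - al) / 2%:R in let l := (al + be) / 2%:R in
    [/\ x != 0,
        [/\ s - k != 0, s + k != 0, s + l != 0 & s - l != 0],
        [/\ x1 = x / (s - k), y1 = y / (s - k), x2 = x / (s + k)
          & y2 = y / (s + k)],
        x3 = x / (s + l) /\ y3 = (y + (l ^+ 2 - k ^+ 2)) / (s + l) &
        x4 = x / (s - l) /\ y4 = (y - (l ^+ 2 - k ^+ 2)) / (s - l)].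
Proof.
move=> n2 nab n1 nx2 n12 e12 e13 e23 e24 e14.
have n : x1 - x2 != 0 by rewrite subr_eq0.
have nab' : be - al != 0 by rewrite subr_eq0 eq_sym.
have nD : x1 * x2 * (be - al) != 0 by rewrite !mulf_neq0.
have e3 : x3 * (x1 * be - x2 * al) = x1 * x2 * (be - al).
  apply: (eq_lincomb (congr2 (fun p r => p - r) (congr1 ( *%R x1) e23)
    (congr2 (fun p r => p - r) (congr1 ( *%R x2) e13) (congr1 ( *%R x3) e12)))); ring.
have e4 : x4 * (x2 * be - x1 * al) = x1 * x2 * (be - al).
  apply: (eq_lincomb (congr2 (fun p r => p - r) (congr1 ( *%R x2) e14)
    (congr2 +%R (congr1 ( *%R x1) e24) (congr1 ( *%R x4) e12)))); ring.
have n3 : x1 * be - x2 * al != 0.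
  by apply: contraNneq nD => e; rewrite -e3 e mulr0.
have n4 : x2 * be - x1 * al != 0.
  by apply: contraNneq nD => e; rewrite -e4 e mulr0.
(* Here s0 stands for s - k: the requirement x1 (s - k) = x2 (s + k) with 2 k = be - al determines
   it, and then x = x1 s0 and y = y1 s0. *)
pose s0 := (be - al) * x2 / (x1 - x2); pose k := (be - al) / 2%:R.
pose l := (al + be) / 2%:R.
exists (s0 + k), (x1 * s0), (y1 * s0); cbv zeta; rewrite -/k -/l.
have e1 : s0 + k - k = s0 by ring.
have e2 : s0 + k + k = (be - al) * x1 / (x1 - x2).
  by rewrite /s0 /k; field; rewrite n n2.
have e5 : s0 + k + l = (x1 * be - x2 * al) / (x1 - x2).
  by rewrite /s0 /k /l; field; rewrite n n2.
have e6 : s0 + k - l = (x2 * be - x1 * al) / (x1 - x2).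
  by rewrite /s0 /k /l; field; rewrite n n2.
have kl : l ^+ 2 - k ^+ 2 = al * be by rewrite /k /l; field.
have ns0 : s0 != 0 by rewrite /s0 !mulf_neq0 ?invr_eq0.
have x3E : x3 = x1 * x2 * (be - al) / (x1 * be - x2 * al) by rewrite -e3 mulfK.
have x4E : x4 = x1 * x2 * (be - al) / (x2 * be - x1 * al) by rewrite -e4 mulfK.
have y2E : y2 = x2 * y1 / x1 by rewrite -e12 mulrAC mulfV // mul1r.
rewrite e1 e2 e5 e6 kl; split.
- by rewrite mulf_neq0.
- by split; rewrite ?ns0 // !mulf_neq0 ?invr_eq0.
- split.
  + by rewrite mulfK.
  + by rewrite mulfK.
  + by rewrite /s0; field; rewrite n1 n nab'.
  + by rewrite y2E /s0; field; rewrite n1 n nab'.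
- split; first by rewrite x3E /s0; field; rewrite n n3.
  have -> : y3 = al + x3 * (y1 - al) / x1 by rewrite -e13 mulrAC mulfV // mul1r; ring.
  by rewrite x3E /s0; field; rewrite n n3 n1.
- split; first by rewrite x4E /s0; field; rewrite n n4.
  have -> : y4 = be + x4 * (y1 - be) / x1 by rewrite -e14 mulrAC mulfV // mul1r; ring.
  by rewrite x4E /s0; field; rewrite n n4 n1.
Qed.

End AffinePoints.

(** * Ordered quadrangles and the O'Nan configurations they contain *)

Section ONan.
Variables (F : fieldType) (U : {pred point F}).
Implicit Types (A B C D P : point F).

Definition meet_in A B C D :=
  exists X, [/\ X \in U, collinear A B X & collinear C D X].

(* The lines OAB, OCD, ACE and BDE form an O'Nan configuration. *)
Definition ONan_through (O : point F) := exists A B C D E,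
  [/\ [/\ A \in U, B \in U, C \in U, D \in U & E \in U],
      [/\ collinear O A B, collinear O C D, collinear A C E & collinear B D E],
      ~ collinear O A C & [/\ A != B, C != D, B != O & D != O]].

(** Stating the joins through collinearity makes permutations of the vertices and transport along
    automorphisms immediate. *)
Definition triple_quad A B C D :=
  [/\ [/\ A \in U, B \in U, C \in U & D \in U],
      [/\ ~ collinear A B C, ~ collinear A B D, ~ collinear A C D &
          ~ collinear B C D] &
      [/\ meet_in A B C D, meet_in A C B D & meet_in A D B C]].

Lemma meet_inC A B C D : meet_in A B C D -> meet_in C D A B.
Proof. by case=> X [*]; exists X. Qed.

Lemma meet_inCl A B C D : meet_in A B C D -> meet_in B A C D.
Proof. by case=> X [? h ?]; exists X; split=> //; apply: collinearC. Qed.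

Lemma meet_inCr A B C D : meet_in A B C D -> meet_in A B D C.
Proof. by move=> /meet_inC/meet_inCl/meet_inC. Qed.

Lemma triple_quad_swap12 A B C D : triple_quad A B C D -> triple_quad B A C D.
Proof.
case=> [[? ? ? ?] [n1 n2 n3 n4] [m1 m2 m3]]; split; split=> //.
- by move=> /collinearC.
- by move=> /collinearC.
- exact: meet_inCl.
- exact: meet_inC.
- exact: meet_inC.
Qed.

Lemma triple_quad_swap23 A B C D : triple_quad A B C D -> triple_quad A C B D.
Proof.
case=> [[? ? ? ?] [n1 n2 n3 n4] [m1 m2 m3]]; split; split=> //.
- by move=> /collinearAC.
- by move=> /collinearC.
- exact: meet_inCr.
Qed.

Lemma triple_quad_swap34 A B C D : triple_quad A B C D -> triple_quad A B D C.
Proof.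
case=> [[? ? ? ?] [n1 n2 n3 n4] [m1 m2 m3]]; split; split=> //.
- by move=> /collinearAC.
- by move=> /collinearAC.
- exact: meet_inCr.
Qed.

(** Dropping the sides AD and BC leaves four lines meeting in the four vertices and two diagonal
    points: an O'Nan configuration. Since none passes through T_infty, this keeps A and the diagonal
    point on AB affine. *)
Lemma triple_quad_ONan A B C D : triple_quad A B C D ->
  ONan_through A /\ forall X, X \in U -> collinear A B X -> collinear C D X ->
    ONan_through X.
Proof.
case=> [[uA uB uC uD] [n1 n2 n3 n4] [[X [uX ABX CDX]] [Y [uY ACY BDY]] _]].
have [AB AC BC] := noncollinear_neq n1; have [_ AD BD] := noncollinear_neq n2.
have [_ _ CD] := noncollinear_neq n3.
have nXA Z : collinear C D Z -> Z != A.
  by move=> h; apply/eqP=> e; apply: n3; rewrite -e; do 2!apply: collinearCA.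
split=> [|Z uZ ABZ CDZ].
  have YA : Y != A by apply/eqP=> e; apply: n2; rewrite e in BDY; do 2!apply: collinearCA.
  exists B, X, Y, C, D; split; [by split | split | | split].
  - exact: ABX.
  - exact: collinearAC.
  - exact: collinearAC.
  - by do 2!apply: collinearCA.
  - move=> ABY; apply: n1; apply: (@collinear_trans _ A Y); first by rewrite eq_sym.
      exact: collinearAC.
    exact: collinearAC.
  - by apply/eqP=> e; apply: n4; rewrite e; do 2!apply: collinearCA.
  - by apply/eqP=> e; apply: n4; rewrite -e; apply: collinearAC.
  - exact: nXA.
  - by rewrite eq_sym.
exists A, B, C, D, Y; split; [by split | split | | split].
- by do 2!apply: collinearCA.
- by do 2!apply: collinearCA.
- exact: ACY.
- exact: BDY.
- move=> ZAC; apply: n1; apply: (@collinear_trans _ A Z); first by rewrite eq_sym nXA.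
    exact: collinearAC.
  exact: collinearC.
- exact: AB.
- exact: CD.
- by apply/eqP=> e; apply: n4; rewrite e; do 2!apply: collinearCA.
- by apply/eqP=> e; apply: n2; rewrite e.
Qed.
End ONan.

(** * Configurations on the unital: constructions and necessary conditions *)

Section Unital.
Variables (F : fieldType) (phi : {rmorphism F -> F}).
Hypothesis phiK : involutive phi.
Hypothesis two_neq0 : (2 : F) != 0.
Variables (a b : F) (U : {pred point F}).
Hypothesis UP : forall P, P \in U <-> P = T_infty F \/
  exists x y, has_coords P x y 1 /\ affine_unital phi a b x y.
Implicit Types (A B C D P : point F).
Local Notation T := (T_infty F).

Lemma unital_affine P x y : has_coords P x y 1 -> P \in U = affine_unital phi a b x y.
Proof.
move=> hP; apply/idP/idP=> [/UP[e|[x' [y' [h]]]] | u].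
- by have := affine_neq_T_infty hP; rewrite e eqxx.
- by have [-> ->] := affine_coords_inj hP h.
- by apply/UP; right; exists x, y.
Qed.

Lemma unital_coords P : P \in U -> P != T ->
  exists x y, has_coords P x y 1 /\ affine_unital phi a b x y.
Proof. by move=> /UP[-> | //]; rewrite eqxx. Qed.

Lemma no_ONan_through_T_infty : anisotropic phi a b -> ~ ONan_through U T.
Proof.
move=> aniso [A [B [C [D [E [[uA uB uC uD uE] [TAB TCD ACE BDE] n [AB CD BT DT]]]]]]].
have [TA TC AC] := noncollinear_neq n; rewrite eq_sym in TA; rewrite eq_sym in TC.
have BD : B != D.
  apply/eqP=> e; apply: n; rewrite -e in TCD; apply: (@collinear_trans _ _ B).
  - by rewrite eq_sym.
  - exact: collinearAC.
  - exact: collinearAC.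
have ET : E != T by apply/eqP=> e; apply: n; rewrite -e; do 2!apply: collinearCA.
have [x1 [y1 [hA vA]]] := unital_coords uA TA.
have [x1' [y2 [hB vB]]] := unital_coords uB BT.
have [x2 [z1 [hC vC]]] := unital_coords uC TC.
have [x2' [z2 [hD vD]]] := unital_coords uD DT.
have [x [y [hE vE]]] := unital_coords uE ET.
move/(collinear_T_infty hA hB): TAB => e1; move/(collinear_T_infty hC hD): TCD => e2.
rewrite -{}e1 in hB vB; rewrite -{}e2 in hD vD.
have [s [t est]] := iffLR (collinear_coords AC hA hC hE) ACE.
have [s' [t' est']] := iffLR (collinear_coords BD hB hD hE) BDE.
rewrite !mulr1 in est est'.
apply: (affine_no_ONan phiK aniso vA vB vC vD vE _ _ _ est est').
- by apply/eqP=> e; apply: n; apply/(collinear_T_infty hA hC).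
- by have := neq_affine hA hB AB; rewrite eqxx.
- by have := neq_affine hC hD CD; rewrite eqxx.
Qed.

(** The shear moves P to the origin. There the configuration consists of (0, -1) and (0, 1) on the
    vertical line and of the three points of [ONan_equations]. *)
Lemma ONan_through_affine P (s w x : F) : P \in U -> P != T ->
    imag phi s != 0 -> w + phi w = -1 ->
    a * x ^+ 2 = w * s * (s ^+ 2 - 1) ->
  ONan_through U P.
Proof.
move=> uP nP ns ew ea.
have ns1 := imag_neq0_add (rmorph1 phi) ns.
have phiN1 : phi (-1) = -1 by rewrite rmorphN rmorph1.
have ns2 := imag_neq0_add phiN1 ns.
have ns0 := imag_neq0_add (rmorph0 phi) ns; rewrite addr0 in ns0.
have nx : x != 0.
  apply: contraTneq isT => e; move/eqP: ea; rewrite e expr0n mulr0 eq_sym.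
  rewrite (_ : s ^+ 2 - 1 = (s - 1) * (s + 1)); last by ring.
  rewrite !mulf_eq0 (negPf ns0) (negPf ns1) (negPf ns2) !orbF => /eqP w0.
  by move/eqP: ew; rewrite w0 rmorph0 addr0 eq_sym oppr_eq0 oner_eq0.
have [y [v1 v2 v3]] := ONan_equations phiK b ns ew ea.
have [x0 [y0 [hP vP]]] := unital_coords uP nP.
have [m em] : exists m, m = 2%:R * a * x0 + imag phi b * phi x0 by eexists.
have pt X Y : affine_unital phi a b X Y ->
    exists Q, has_coords Q (X + x0) (Y + m * X + y0) 1 /\ Q \in U.
  move=> v; have [Q hQ] := affine_point_exists (X + x0) (Y + m * X + y0).
  by exists Q; split=> //; rewrite (unital_affine hQ) em affine_unital_shear.
have q0 c : phi c = c -> affine_unital phi a b 0 c.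
  move=> ec; apply/eqP; rewrite /imag ec subrr !(expr0n, mul0r, mulr0) addr0 rmorph0.
  by rewrite subrr.
have [A [hA uA]] := pt _ _ (q0 (-1) phiN1).
have [B [hB uB]] := pt _ _ (q0 1 (rmorph1 phi)).
have [C [hC uC]] := pt _ _ v1; have [D [hD uD]] := pt _ _ v2.
have [E [hE uE]] := pt _ _ v3.
have nPAD : ~ collinear P A D.
  move/(collinear_affine hP hA hD) => e.
  have : x / (s + 1) = 0 by apply: (eq_lincomb e); field.
  by move/eqP; rewrite mulf_eq0 invr_eq0 (negPf nx) (negPf ns1).
have nPBC : ~ collinear P B C.
  move/(collinear_affine hP hB hC) => e.
  have : x / (s - 1) = 0 by apply: (eq_lincomb (esym e)); field.
  by move/eqP; rewrite mulf_eq0 invr_eq0 (negPf nx) (negPf ns2).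
have [PB PC _] := noncollinear_neq nPBC.
exists A, B, D, C, E; split; [by split | split | exact: nPAD | split].
- by apply/(collinear_affine hP hA hB); ring.
- by apply/(collinear_affine hP hD hC); field; rewrite ns1 ns2.
- by apply/(collinear_affine hA hD hE); field; rewrite ns1 ns0.
- by apply/(collinear_affine hB hC hE); field; rewrite ns2 ns0.
- apply/eqP=> e; rewrite e in hA; have [_ /eqP] := affine_coords_inj hA hB.
  rewrite -subr_eq0 (_ : _ - _ = - 2) ?oppr_eq0 ?(negPf two_neq0) //.
  by ring.
- apply/eqP=> e; rewrite e in hD; have [/eqP + _] := affine_coords_inj hD hC.
  rewrite -subr_eq0 (_ : _ - _ = - 2 * x / ((s - 1) * (s + 1))); last first.
    by field; rewrite ns1 ns2.
  by rewrite !mulf_eq0 invr_eq0 mulf_eq0 oppr_eq0 (negPf two_neq0) (negPf nx)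
    (negPf ns1) (negPf ns2).
- by rewrite eq_sym.
- by rewrite eq_sym.
Qed.

Lemma triple_quad_exists (s k l w x : F) :
    imag phi s != 0 -> phi k = k -> phi l = l -> k != 0 -> k ^+ 2 != l ^+ 2 ->
    w * s + phi (w * s) = 0 -> l * (w + phi w) = -1 ->
    a * x ^+ 2 = w * (s ^+ 2 - k ^+ 2) * (s ^+ 2 - l ^+ 2) ->
  exists A B C D, triple_quad U A B C D /\ collinear T A B.
Proof.
move=> ns ek el nk nkl ews ew ea.
have ek' : phi (- k) = - k by rewrite rmorphN ek.
have el' : phi (- l) = - l by rewrite rmorphN el.
have n1 := imag_neq0_add ek ns; have n2 := imag_neq0_add ek' ns.
have n3 := imag_neq0_add el ns; have n4 := imag_neq0_add el' ns.
have : k ^+ 2 - l ^+ 2 != 0 by rewrite subr_eq0.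
rewrite subr_sqr mulf_eq0 negb_or => /andP[n5 n6].
have n5' : l - k != 0 by rewrite -opprB oppr_eq0.
have n6' : l + k != 0 by rewrite addrC.
have nx : x != 0.
  apply: contraTneq isT => e; move/eqP: ea; rewrite e expr0n mulr0 eq_sym.
  rewrite !subr_sqr !mulf_eq0 (negPf n1) (negPf n2) (negPf n3) (negPf n4) !orbF => /eqP w0.
  by move/eqP: ew; rewrite w0 rmorph0 addr0 mulr0 eq_sym oppr_eq0 oner_eq0.
have [y [v1 v2 v3 v4]] := triple_equations phiK b ns ek el ews ew ea.
have pt X Y : affine_unital phi a b X Y -> exists Q, has_coords Q X Y 1 /\ Q \in U.
  move=> v; have [Q hQ] := affine_point_exists X Y.
  by exists Q; split=> //; rewrite (unital_affine hQ).
have q0 c : phi c = c -> affine_unital phi a b 0 c.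
  move=> ec; apply/eqP; rewrite /imag ec subrr !(expr0n, mul0r, mulr0) addr0 rmorph0.
  by rewrite subrr.
have [A [hA uA]] := pt _ _ (q0 (l - k) ltac:(by rewrite rmorphB ek el)).
have [B [hB uB]] := pt _ _ (q0 (l + k) ltac:(by rewrite rmorphD ek el)).
(* [X], [E] and [G] are the diagonal points AB.CD, AC.BD and AD.BC. *)
have [X [hX uX]] := pt _ _ (q0 0 (rmorph0 phi)).
have [C [hC uC]] := pt _ _ v1; have [D [hD uD]] := pt _ _ v2.
have [E [hE uE]] := pt _ _ v3; have [G [hG uG]] := pt _ _ v4.
exists A, B, C, D; split; last by apply/(collinear_T_infty hA hB).
split; split=> //.
- move/(collinear_affine hA hB hC) => e.
  have : 2%:R * k * x / (s - k) = 0 by apply: (eq_lincomb (esym e)); field.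
  by move/eqP; rewrite !mulf_eq0 invr_eq0 (negPf nx) (negPf n2) (negPf two_neq0) (negPf nk).
- move/(collinear_affine hA hB hD) => e.
  have : 2%:R * k * x / (s + k) = 0 by apply: (eq_lincomb (esym e)); field.
  by move/eqP; rewrite !mulf_eq0 invr_eq0 (negPf nx) (negPf n1) (negPf two_neq0) (negPf nk).
- move/(collinear_affine hA hC hD) => e.
  have : 2%:R * k * x * (l - k) / ((s + k) * (s - k)) = 0.
    by apply: (eq_lincomb (esym e)); field; rewrite n1 n2.
  by move/eqP; rewrite !mulf_eq0 invr_eq0 mulf_eq0 (negPf nx) (negPf n1) (negPf n2)
    (negPf two_neq0) (negPf nk) (negPf n5').
- move/(collinear_affine hB hC hD) => e.
  have : 2%:R * k * x * (l + k) / ((s + k) * (s - k)) = 0.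
    by apply: (eq_lincomb (esym e)); field; rewrite n1 n2.
  by move/eqP; rewrite !mulf_eq0 invr_eq0 mulf_eq0 (negPf nx) (negPf n1) (negPf n2)
    (negPf two_neq0) (negPf nk) (negPf n6').
- exists X; split=> //.
  + by apply/(collinear_affine hA hB hX); ring.
  + by apply/(collinear_affine hC hD hX); field; rewrite n1 n2.
- exists E; split=> //.
  + by apply/(collinear_affine hA hC hE); field; rewrite n2 n3.
  + by apply/(collinear_affine hB hD hE); field; rewrite n1 n3.
- exists G; split=> //.
  + by apply/(collinear_affine hA hD hG); field; rewrite n1 n4.
  + by apply/(collinear_affine hB hC hG); field; rewrite n2 n4.
Qed.

Lemma triple_affine_nec x0 y0 yA yB x1 y1 x2 y2 x3 y3 x4 y4 :
    anisotropic phi a b ->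
    affine_unital phi a b x0 y0 ->
    affine_unital phi a b x0 yA -> affine_unital phi a b x0 yB ->
    affine_unital phi a b x1 y1 -> affine_unital phi a b x2 y2 ->
    affine_unital phi a b x3 y3 -> affine_unital phi a b x4 y4 ->
    yA - y0 != 0 -> yB - y0 != 0 -> yA - y0 != yB - y0 ->
    x1 - x0 != 0 -> x2 - x0 != 0 -> x1 - x0 != x2 - x0 ->
    (x1 - x0) * (y2 - y0) = (x2 - x0) * (y1 - y0) ->
    (x1 - x0) * (y3 - yA) = (x3 - x0) * (y1 - yA) ->
    (x2 - x0) * (y3 - yB) = (x3 - x0) * (y2 - yB) ->
    (x2 - x0) * (y4 - yA) = (x4 - x0) * (y2 - yA) ->
    (x1 - x0) * (y4 - yB) = (x4 - x0) * (y1 - yB) ->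
  exists s k l x,
    [/\ [/\ imag phi s != 0, phi k = k & phi l = l],
        [/\ k != 0, l != 0 & k ^+ 2 != l ^+ 2], x != 0 &
        let w := a * x ^+ 2 / ((s ^+ 2 - k ^+ 2) * (s ^+ 2 - l ^+ 2)) in
        w * s + phi (w * s) = 0].
Proof.
move=> aniso vX vA vB vC vD vE vG nA nB nab n1' n2' n12 e12 e13 e23 e24 e14.
have [m em] : exists m, m = 2%:R * a * x0 + imag phi b * phi x0 by eexists.
have sh x y : affine_unital phi a b x y ->
    affine_unital phi a b (x - x0) (y - y0 - m * (x - x0)).
  rewrite -(affine_unital_shear phiK (x - x0) (y - y0 - m * (x - x0)) vX) -em.
  rewrite subrK; congr affine_unital; ring.
have fixed y : affine_unital phi a b x0 y -> phi (y - y0) = y - y0.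
  by move=> /eqP v; apply: phi_eq_imag; rewrite v -(eqP vX).
have eal := fixed _ vA; have ebe := fixed _ vB.
have [|||||s [x [y]]] := @triple_parametrization _ (yA - y0) (yB - y0)
  (x1 - x0) (y1 - y0 - m * (x1 - x0)) (x2 - x0) (y2 - y0 - m * (x2 - x0))
  (x3 - x0) (y3 - y0 - m * (x3 - x0)) (x4 - x0) (y4 - y0 - m * (x4 - x0))
  two_neq0 nab n1' n2' n12.
- by apply: (eq_lincomb e12); ring.
- by apply: (eq_lincomb e13); ring.
- by apply: (eq_lincomb e23); ring.
- by apply: (eq_lincomb e24); ring.
- by apply: (eq_lincomb e14); ring.
set k := _ / _; set l := _ / _ => -[nx [m1 m2 m3 m4] [q1 q1' q2 q2'] [q3 q3'] [q4 q4']].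
have ek : phi k = k by rewrite rmorphM fmorphV rmorph_nat (rmorphB phi (yB - y0)) ebe eal.
have el : phi l = l by rewrite rmorphM fmorphV rmorph_nat (rmorphD phi (yA - y0)) ebe eal.
have nk : k != 0.
  by rewrite mulf_neq0 ?invr_eq0 // subr_eq0 eq_sym.
have nkl : k ^+ 2 != l ^+ 2.
  have -> : k ^+ 2 = l ^+ 2 - (yA - y0) * (yB - y0) by rewrite /k /l; field.
  rewrite -subr_eq0 addrAC subrr add0r oppr_eq0 mulf_neq0 //.
move: (sh _ _ vC) (sh _ _ vD) (sh _ _ vE) (sh _ _ vG).
rewrite q1' q1 q2' q2 q3' q3 q4' q4 => w1 w2 w3 w4.
(* If s were fixed, the equations of C and D would read (s - k) Im y = Q(x) and (s + k) Im y = Q(x),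
   with Q the anisotropic form. Hence Im y = 0 and Q(x) = 0, so x = 0. *)
have ns : imag phi s != 0.
  apply: contraNneq nx => s0; apply/eqP/aniso.
  have eqs : phi s = s by apply/esym/eqP; rewrite -subr_eq0 -s0.
  have is1 : imag phi (s - k) = 0 by rewrite /imag rmorphB eqs ek subrr.
  have is2 : imag phi (s + k) = 0 by rewrite /imag rmorphD eqs ek subrr.
  rewrite affine_unital_div // is1 mul0r subr0 rmorphB eqs ek in w1.
  rewrite affine_unital_div // is2 mul0r subr0 rmorphD eqs ek in w2.
  have nz : 2%:R * k != 0 by rewrite mulf_neq0.
  have iy : y - phi y = 0.
    apply: (mulfI nz); apply: (eq_lincomb (congr2 (fun p r => p - r) (eqP w2) (eqP w1))).
    by ring.
  apply: (eq_lincomb (congr2 (fun p r => p - r) (congr1 ( *%R (s - k)) iy) (eqP w1))).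
  by rewrite /imag !(rmorphD, rmorphM, rmorphXn) phiK; ring.
have [nl ew] := triple_equations_nec phiK two_neq0 ns ek el nk nkl w1 w2 w3 w4.
by exists s, k, l, x.
Qed.

(** All seven points are affine: A, B and AB.CD lie on O'Nan configurations, and if any of the other
    four were T_infty, then C or D would lie on AB. [triple_affine_nec] then applies. *)
Lemma triple_quad_nec A B C D : anisotropic phi a b ->
    triple_quad U A B C D -> collinear T A B ->
  exists s k l x,
    [/\ [/\ imag phi s != 0, phi k = k & phi l = l],
        [/\ k != 0, l != 0 & k ^+ 2 != l ^+ 2], x != 0 &
        let w := a * x ^+ 2 / ((s ^+ 2 - k ^+ 2) * (s ^+ 2 - l ^+ 2)) in
        w * s + phi (w * s) = 0].
Proof.
move=> aniso tq TAB; have noT := no_ONan_through_T_infty aniso.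
have [oA oX] := triple_quad_ONan tq.
have [oB _] := triple_quad_ONan (triple_quad_swap12 tq).
have nT P : ONan_through U P -> P != T by move=> oP; apply/eqP=> e; rewrite e in oP.
have [[uA uB uC uD] [n1 n2 n3 n4]
  [[X [uX ABX CDX]] [E [uE ACE BDE]] [G [uG ADG BCG]]]] := tq.
have [AB AC BC] := noncollinear_neq n1; have [_ AD BD] := noncollinear_neq n2.
have [_ _ CD] := noncollinear_neq n3.
have AT := nT _ oA; have BT := nT _ oB; have XT := nT _ (oX _ uX ABX CDX).
have CT : C != T by apply/eqP=> e; apply: n1; rewrite e; apply: collinearCA.
have DT : D != T by apply/eqP=> e; apply: n2; rewrite e; apply: collinearCA.
have ET : E != T.
  apply/eqP=> e; rewrite e in ACE; apply: n1.
  apply: (@collinear_trans _ A T); first exact: AT.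
    exact: collinearC.
  exact: collinearAC.
have GT : G != T.
  apply/eqP=> e; rewrite e in ADG; apply: n2.
  apply: (@collinear_trans _ A T); first exact: AT.
    exact: collinearC.
  exact: collinearAC.
have [x0 [y0 [hX vX]]] := unital_coords uX XT.
have [xA [yA [hA vA]]] := unital_coords uA AT.
have [xB [yB [hB vB]]] := unital_coords uB BT.
have [x1 [y1 [hC vC]]] := unital_coords uC CT.
have [x2 [y2 [hD vD]]] := unital_coords uD DT.
have [x3 [y3 [hE vE]]] := unital_coords uE ET.
have [x4 [y4 [hG vG]]] := unital_coords uG GT.
have exAB := iffLR (collinear_T_infty hA hB) TAB.
have exA : xA = x0.
  apply/(collinear_T_infty hA hX)/collinearC.
  by apply: (@collinear_trans _ A B T X) => [||//]; first exact: AB; apply: collinearCA.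
rewrite exA in hA vA exAB *; rewrite -exAB in hB vB.
have TA_out P x y : has_coords P x y 1 -> ~ collinear A B P -> x - x0 != 0.
  move=> hP nP; rewrite subr_eq0; apply/eqP=> e; apply: nP.
  apply: (@collinear_trans _ A T); [exact: AT | exact: collinearC | apply: collinearC].
  by apply/(collinear_T_infty hA hP).
have n1' := TA_out _ _ _ hC n1; have n2' := TA_out _ _ _ hD n2.
have e12 : (x1 - x0) * (y2 - y0) = (x2 - x0) * (y1 - y0).
  by apply/(collinear_affine hX hC hD); do 2!apply: collinearCA.
have n12 : x1 - x0 != x2 - x0.
  apply/eqP=> e; have ex : x1 = x2 by rewrite -[x1](subrK x0) e subrK.
  have := neq_affine hC hD CD; rewrite ex eqxx /=; apply/negP/negPn/eqP.
  apply: (addIr (- y0)); apply: (mulfI n2'); rewrite -{1}e12 ex //.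
have dy P yP : has_coords P x0 yP 1 -> P != X -> yP - y0 != 0.
  move=> hP nP; rewrite subr_eq0; have := neq_affine hP hX nP.
  by rewrite eqxx.
have [|||s [k [l [x h]]]] := @triple_affine_nec x0 y0 yA yB x1 y1 x2 y2 x3 y3 x4 y4
  aniso vX vA vB vC vD vE vG _ _ _ n1' n2' n12 e12 (iffLR (collinear_affine hA hC hE) ACE)
  (iffLR (collinear_affine hB hD hE) BDE) (iffLR (collinear_affine hA hD hG) ADG)
  (iffLR (collinear_affine hB hC hG) BCG).
- apply: (dy A _ hA); apply/eqP=> e; apply: n3.
  by rewrite e; do 2!apply: collinearCA.
- apply: (dy B _ hB); apply/eqP=> e; apply: n4.
  by rewrite e; do 2!apply: collinearCA.
- by have := neq_affine hA hB AB; rewrite eqxx (inj_eq (addIr _)).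
- by exists s, k, l, x.
Qed.

End Unital.

(** * Triple O'Nans as sets of lines, and their images under automorphisms *)

Lemma uniq4 (T : eqType) (a b c d : T) :
  a != b -> a != c -> a != d -> b != c -> b != d -> c != d ->
  uniq [:: a; b; c; d].
Proof. by rewrite /= !inE !negb_or => -> -> -> -> -> ->. Qed.

Section Configurations.
Variable F : fieldType.
Implicit Types (U V : {pred point F}) (A B C D P : point F).

Lemma joins_meet_inP U A B C D : A != B -> C != D ->
  joins_meet_in U A B C D <-> meet_in U A B C D.
Proof.
move=> AB CD; split=> -[X [uX h1 h2]]; exists X; split=> //.
- exact/(collinearP X AB).
- exact/(collinearP X CD).
- exact/(collinearP X AB).
- exact/(collinearP X CD).
Qed.

Lemma triple_quadP U A B C D : triple_quad U A B C D <->
  [/\ [/\ A \in U, B \in U, C \in U & D \in U], quadrangle A B C D &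
      [/\ joins_meet_in U A B C D, joins_meet_in U A C B D &
          joins_meet_in U A D B C]].
Proof.
split=> -[u].
  move=> [n1 n2 n3 n4] [m1 m2 m3].
  have [AB AC BC] := noncollinear_neq n1; have [_ AD BD] := noncollinear_neq n2.
  have [_ _ CD] := noncollinear_neq n3.
  split; first exact: u.
    split; last exact: And4 n1 n2 n3 n4.
    exact: uniq4 AB AC AD BC BD CD.
  split; apply/joins_meet_inP; [exact: AB | exact: CD | exact: m1 | exact: AC
    | exact: BD | exact: m2 | exact: AD | exact: BC | exact: m3].
move=> [_ [n1 n2 n3 n4]] [m1 m2 m3].
have [AB AC BC] := noncollinear_neq n1; have [_ AD BD] := noncollinear_neq n2.
have [_ _ CD] := noncollinear_neq n3.
split; [exact: u | exact: And4 n1 n2 n3 n4 |].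
split; apply/joins_meet_inP; [exact: AB | exact: CD | exact: m1 | exact: AC
  | exact: BD | exact: m2 | exact: AD | exact: BC | exact: m3].
Qed.

(** Permutations of the vertices act transitively on the six sides, so the side through T_infty may
    be taken to be AB. *)
Lemma BM_special_triple U :
  (exists T : {pred line F}, triple_ONan U T /\ BM_special T) <->
  (exists A B C D, triple_quad U A B C D /\ collinear (T_infty F) A B).
Proof.
split.
  case=> T [[A [B [C [D [u qd m TP]]]]] [L /TP[P [Q [inP inQ PQ iP iQ]]] iT]].
  have tq : triple_quad U A B C D by apply/triple_quadP.
  have col : collinear (T_infty F) P Q by exists L.
  have s1 := triple_quad_swap12; have s2 := triple_quad_swap23.
  have s3 := triple_quad_swap34.
  have tcol : collinear (T_infty F) Q P by apply: collinearAC.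
  move: inP inQ PQ col tcol; rewrite !inE.
  have tq13 := s2 _ _ _ _ _ _ tq; have tq14 := s2 _ _ _ _ _ _ (s3 _ _ _ _ _ _ tq).
  have tq23 := s2 _ _ _ _ _ _ (s1 _ _ _ _ _ _ tq).
  have tq24 := s2 _ _ _ _ _ _ (s3 _ _ _ _ _ _ (s1 _ _ _ _ _ _ tq)).
  have tq34 := s2 _ _ _ _ _ _ (s3 _ _ _ _ _ _ (s1 _ _ _ _ _ _ tq13)).
  move=> /or4P[] /eqP-> /or4P[] /eqP-> ne c c'.
  - by rewrite eqxx in ne.
  - exists A, B, C, D; split; [exact: tq | exact: c].
  - exists A, C, B, D; split; [exact: tq13 | exact: c].
  - exists A, D, B, C; split; [exact: tq14 | exact: c].
  - exists A, B, C, D; split; [exact: tq | exact: c'].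
  - by rewrite eqxx in ne.
  - exists B, C, A, D; split; [exact: tq23 | exact: c].
  - exists B, D, A, C; split; [exact: tq24 | exact: c].
  - exists A, C, B, D; split; [exact: tq13 | exact: c'].
  - exists B, C, A, D; split; [exact: tq23 | exact: c'].
  - by rewrite eqxx in ne.
  - exists C, D, A, B; split; [exact: tq34 | exact: c].
  - exists A, D, B, C; split; [exact: tq14 | exact: c'].
  - exists B, D, A, C; split; [exact: tq24 | exact: c'].
  - exists C, D, A, B; split; [exact: tq34 | exact: c'].
  - by rewrite eqxx in ne.
case=> A [B [C [D [tq col]]]]; have [u qd m] := iffLR (triple_quadP U A B C D) tq.
pose s := [:: A; B; C; D].
pose T : {pred line F} := [pred L : line F |
  has (fun P => has (fun Q => [&& P != Q, incident P L & incident Q L]) s) s].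
exists T; split.
  exists A, B, C, D; split; [exact: u | exact: qd | exact: m | move=> L; split].
    by case/hasP=> P inP /hasP[Q inQ /and3P[PQ iP iQ]]; exists P, Q.
  case=> P [Q [inP inQ PQ iP iQ]]; apply/hasP; exists P; first exact: inP.
  by apply/hasP; exists Q; [exact: inQ | rewrite PQ iP iQ].
have [_ [n1 _ _ _] _] := tq; have [AB _ _] := noncollinear_neq n1.
have [L [iT iA iB]] := col; exists L; last exact: iT.
apply/hasP; exists A; first exact: mem_head.
apply/hasP; exists B; first by rewrite in_cons mem_head orbT.
exact/and3P.
Qed.

Section Automorphism.
Variables (f : point F -> point F) (U V : {pred point F}).
Hypothesis f_auto : plane_automorphism f.
Hypothesis fUV : forall P, (f P \in V) = (P \in U).

Lemma collinear_automorphism P Q R :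
  collinear (f P) (f Q) (f R) <-> collinear P Q R.
Proof.
have [_ [g [[g' gK g'K] fg]]] := f_auto; split=> -[L [iP iQ iR]].
  by exists (g' L); split; rewrite -fg g'K.
by exists (g L); rewrite !fg.
Qed.

Lemma meet_in_automorphism A B C D :
  meet_in U A B C D -> meet_in V (f A) (f B) (f C) (f D).
Proof.
case=> X [uX h1 h2]; exists (f X); rewrite fUV; split; first exact: uX.
  exact/collinear_automorphism.
exact/collinear_automorphism.
Qed.

Lemma triple_quad_automorphism A B C D :
  triple_quad U A B C D -> triple_quad V (f A) (f B) (f C) (f D).
Proof.
case=> [u [n1 n2 n3 n4] [m1 m2 m3]]; split.
- by rewrite !fUV.
- by split; move=> /collinear_automorphism;
    [move/n1 | move/n2 | move/n3 | move/n4].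
- split; apply: meet_in_automorphism; [exact: m1 | exact: m2 | exact: m3].
Qed.

Lemma ONan_through_automorphism P : ONan_through V (f P) -> ONan_through U P.
Proof.
have [[f' fK f'K] _] := f_auto.
case=> A [B [C [D [E]]]]; rewrite -[A]f'K -[B]f'K -[C]f'K -[D]f'K -[E]f'K !fUV.
rewrite !(inj_eq (can_inj fK)) => -[u [h1 h2 h3 h4] n ne].
exists (f' A), (f' B), (f' C), (f' D), (f' E); split; [exact: u | | | exact: ne].
  split; apply/collinear_automorphism; [exact: h1 | exact: h2 | exact: h3 | exact: h4].
by move=> /collinear_automorphism/n.
Qed.

End Automorphism.
End Configurations.

(** * The field of order q^2 and its involution *)

Section FiniteField.
Variables (p n q : nat) (F : finFieldType).
Hypotheses (p_prime : prime p) (n_gt0 : (0 < n)%N) (q_def : q = (p ^ n)%N)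
  (q_odd : odd q) (cardF : #|F| = (q ^ 2)%N).

(** The q-th power map is the n-fold iterate of Frobenius, built by induction so that it is a ring
    morphism by construction. *)
Lemma finite_conjugation :
  exists phi : {rmorphism F -> F}, (forall x, phi x = x ^+ q) /\ involutive phi.
Proof.
have chF : p \in [pchar F].
  by apply: (@card_finPcharP F p (n * 2)); rewrite // cardF q_def expnM.
have [phi phiE] : exists phi : {rmorphism F -> F}, forall x, phi x = x ^+ q.
  rewrite q_def; elim: (n) => [|m [phi phiE]]; first by exists idfun.
  exists (phi \o pFrobenius_aut chF) => x /=.
  by rewrite phiE pFrobenius_autE -exprM expnS.
exists phi; split=> // x; rewrite !phiE -exprM -[RHS]expf_card cardF.
by rewrite expnS expn1.
Qed.

Lemma finite_natq_eq0 : q%:R = 0 :> F.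
Proof.
have chF : p \in [pchar F].
  by apply: (@card_finPcharP F p (n * 2)); rewrite // cardF q_def expnM.
by rewrite q_def natrX (pcharf0 chF) expr0n eqn0Ngt n_gt0.
Qed.

Lemma finite_two_neq0 : (2 : F) != 0.
Proof.
apply: contra_eq_neq finite_natq_eq0 => two0; rewrite -(odd_double_half q) q_odd -muln2.
by rewrite natrD natrM two0 mulr0 addr0 oner_neq0.
Qed.

End FiniteField.

(** * The quadratic character of F and primitive elements *)

Section QuadraticCharacter.
Variables (q : nat) (F : finFieldType) (phi : {rmorphism F -> F}).
Hypotheses (phiE : forall x, phi x = x ^+ q) (phiK : involutive phi).
Hypotheses (q_odd : odd q) (q_gt1 : (1 < q)%N) (cardF : #|F| = (q ^ 2)%N).
Implicit Types (x y a b : F).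

(* By Euler's criterion this is the quadratic character of F. *)
Definition chi x := x ^+ (#|F|.-1)./2.

Let half_card : ((#|F|.-1)./2 * 2)%N = #|F|.-1.
Proof. by rewrite cardF; lia. Qed.

Let card_pred : #|F|.-1 = ((q - 1) * (q + 1))%N.
Proof. by rewrite cardF; lia. Qed.

Lemma chiM x y : chi (x * y) = chi x * chi y.
Proof. exact: exprMn. Qed.

Lemma chiX x i : chi (x ^+ i) = chi x ^+ i.
Proof. by rewrite /chi -!exprM mulnC. Qed.

Lemma expf_pred x : x != 0 -> x ^+ #|F|.-1 = 1.
Proof.
move=> nx; apply: (mulfI nx); rewrite -exprS prednK ?expf_card ?mulr1 //.
by rewrite cardF expn_gt0 (ltnW q_gt1).
Qed.

Lemma chi_sqr x : x != 0 -> chi x * chi x = 1.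
Proof. by move=> nx; rewrite -expr2 /chi -exprM half_card expf_pred. Qed.

Lemma chi_pm x : x != 0 -> chi x = 1 \/ chi x = -1.
Proof.
by move=> /chi_sqr/eqP; rewrite -expr2 sqrf_eq1 => /orP[] /eqP; [left | right].
Qed.

Lemma chiV x : x != 0 -> chi x^-1 = chi x.
Proof.
move=> nx; rewrite /chi exprVn -/(chi x) -[LHS]mulr1 -(chi_sqr nx).
by rewrite mulKf // expf_neq0.
Qed.

Lemma expf_fixed x : phi x = x -> x != 0 -> x ^+ q.-1 = 1.
Proof.
rewrite phiE => e nx; apply: (mulfI nx).
by rewrite mulr1 -exprS prednK // ltnW.
Qed.

Lemma phi_imag x : phi (imag phi x) = - imag phi x.
Proof. by rewrite /imag rmorphB phiK opprB. Qed.

(** The exponent (q^2 - 1) / 2 is a multiple of q - 1, because q + 1 is even. *)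
Lemma chi_fixed x : phi x = x -> x != 0 -> chi x = 1.
Proof.
move=> ex nx; have := expf_fixed ex nx; rewrite -subn1.
have e2 : ((q + 1)./2).*2 = (q + 1)%N by lia.
rewrite /chi (_ : (_./2) = ((q - 1) * (q + 1)./2)%N); last first.
  by rewrite card_pred -{1}e2 -doubleMr doubleK.
by move=> e1; rewrite exprM e1 expr1n.
Qed.

Lemma primitive_element : exists g : F, (#|F|.-1).-primitive_root g.
Proof.
have : has (#|F|.-1).-primitive_root (enum [pred x : F | x != 0]).
  apply: cyclic.has_prim_root.
  - by rewrite card_pred muln_gt0 subn_gt0 q_gt1 addn1.
  - by apply/allP=> x; rewrite mem_enum inE unity_rootE => /expf_pred->.
  - exact: enum_uniq.
  - rewrite -cardE -(cardC1 (0 : F)); apply: eq_leq; apply: eq_card => x.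
    by rewrite !inE.
by case/hasP=> g _ prim_g; exists g.
Qed.

Lemma chi_square x : x != 0 -> chi x = 1 -> exists y, x = y ^+ 2.
Proof.
move=> nx; have [g prim_g] := primitive_element.
have [[i _] /= ->] := prim_rootP prim_g (expf_pred nx).
have := half_card; rewrite /chi; set h := (_./2) => eh.
have h_gt0 : (0 < h)%N by move: eh; rewrite card_pred; nia.
rewrite -exprM => /eqP; rewrite -(prim_order_dvd prim_g) -eh mulnC dvdn_pmul2r //.
by move=> /dvdnP[j ->]; exists (g ^+ j); rewrite exprM.
Qed.


Section Primitive.
Variable g : F.
Hypothesis prim_g : (#|F|.-1).-primitive_root g.

Lemma prim_neq0 : g != 0.
Proof.
apply/eqP=> g0; have := prim_expr_order prim_g; rewrite g0 expr0n.
rewrite -half_card; case: eqP => [e|_ /eqP]; last by rewrite eq_sym oner_eq0.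
by move: e; rewrite half_card card_pred; nia.
Qed.

Lemma chi_prim : chi g = -1.
Proof.
have [/eqP|//] := chi_pm prim_neq0; rewrite /chi -(prim_order_dvd prim_g).
have := half_card; set h := (_./2) => eh /dvdn_leq; rewrite -eh => le.
by have := card_pred; nia.
Qed.

Lemma prim_pow_neq1 i : (0 < i)%N -> (i < q + 1)%N -> g ^+ (i * (q - 1)) != 1.
Proof.
move=> i0 iq; rewrite -(prim_order_dvd prim_g) card_pred mulnC dvdn_pmul2r.
  by apply/negP=> /dvdn_leq -/(_ i0); lia.
by lia.
Qed.

Lemma imag_prim_pow i : (0 < i)%N -> (i < q + 1)%N -> imag phi (g ^+ i) != 0.
Proof.
move=> i0 iq; rewrite /imag subr_eq0 eq_sym phiE; apply: contra (prim_pow_neq1 i0 iq) => /eqP e.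
apply/eqP; apply: (@mulfI _ (g ^+ i)); first by rewrite expf_neq0 // prim_neq0.
by rewrite exprM -exprS mulr1 (_ : (q - 1).+1 = q) //; lia.
Qed.

(** If g^q = - g, then g^(2 (q - 1)) = 1, which is impossible since 2 < q + 1. *)
Lemma trace_prim_neq0 : g + phi g != 0.
Proof.
have [|] := boolP (3 <= q + 1)%N => [q2|]; last by lia.
apply: contra (prim_pow_neq1 (isT : 0 < 2)%N q2); rewrite addrC addr_eq0 phiE => /eqP e.
have -> : g ^+ (2 * (q - 1)) = (g ^+ q / g) ^+ 2.
  rewrite mulnC exprM; congr (_ ^+ _); apply: (mulIf prim_neq0).
  by rewrite divfK ?prim_neq0 // -exprSr (_ : (q - 1).+1 = q) //; lia.
by rewrite e mulNr mulfV ?prim_neq0 // sqrrN expr1n.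
Qed.

Lemma norm_prim_fixed i : phi (g ^+ (i * (q + 1))) = g ^+ (i * (q + 1)).
Proof.
rewrite phiE -exprM -mulnA; apply/eqP; rewrite (eq_prim_root_expr prim_g).
rewrite (_ : (i * ((q + 1) * q) = i * #|F|.-1 + i * (q + 1))%N) ?modnMDl //.
by rewrite card_pred; nia.
Qed.

Lemma norm_prim_eq1 i : (g ^+ (i * (q + 1)) == 1) = (q - 1 %| i)%N.
Proof. by rewrite -(prim_order_dvd prim_g) card_pred dvdn_pmul2r // addn1. Qed.

End Primitive.

Hypothesis two_neq0 : (2 : F) != 0.

(** * Choosing the parameters, for large and for small q *)

Section ParametersExist.
Variables (a b : F) (U : {pred point F}).
Hypothesis a_neq0 : a != 0.
Hypothesis UP : forall P, P \in U <-> P = T_infty F \/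
  exists x y, has_coords P x y 1 /\ affine_unital phi a b x y.

Lemma sqr_quotient v : v != 0 -> chi (a * v) = 1 -> exists x, a * x ^+ 2 = v.
Proof.
move=> nv; rewrite chiM => e.
have [|x ex] := @chi_square (v / a) (mulf_neq0 nv (invr_neq0 a_neq0)).
  by rewrite chiM chiV // mulrC.
by exists x; rewrite -ex mulrC divfK.
Qed.

(** Trace -1 is attained both by a square, w = -1/2 in F_q, and by a non-square, w = - g / (g + phi
    g) with g primitive. One of the two makes w v / a a square. *)
Lemma ONan_through_affine_point P : P \in U -> P != T_infty F -> ONan_through U P.
Proof.
move=> uP nP; have [g prim_g] := primitive_element.
have ng := prim_neq0 prim_g.
have ns : imag phi g != 0 by rewrite -[g]expr1; apply: imag_prim_pow => //; lia.
have ng1 := imag_neq0_add (rmorph1 phi) ns.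
have phiN1 : phi (-1) = -1 by rewrite rmorphN rmorph1.
have ng2 := imag_neq0_add phiN1 ns.
pose v := g * (g ^+ 2 - 1).
have nv : v != 0 by rewrite mulf_neq0 // (_ : _ - _ = (g + 1) * (g - 1)) ?mulf_neq0 //; ring.
have [w [nw ew cw]] : exists w, [/\ w != 0, w + phi w = -1 & chi w = chi (a * v)].
  have [-> | ->] := chi_pm (mulf_neq0 a_neq0 nv).
    exists (- 2^-1); have e : phi (- 2^-1) = - 2^-1 by rewrite rmorphN fmorphV rmorph_nat.
    split; [by rewrite oppr_eq0 invr_eq0 | by rewrite e; field |].
    by apply: chi_fixed => //; rewrite oppr_eq0 invr_eq0.
  have nt := trace_prim_neq0 prim_g; set t := g + phi g in nt.
  have et : phi t = t by rewrite /t rmorphD phiK addrC.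
  exists (- g / t); split.
  - by rewrite mulf_neq0 ?oppr_eq0 ?invr_eq0.
  - by rewrite rmorphM rmorphN fmorphV et /t; field.
  - rewrite mulNr -mulrN chiM chi_prim // chi_fixed ?mulr1 //.
      by rewrite rmorphN fmorphV et.
    by rewrite oppr_eq0 invr_eq0.
have [|x ex] := @sqr_quotient (w * v) (mulf_neq0 nw nv).
  by rewrite mulrCA chiM cw chi_sqr // mulf_neq0.
by apply: (ONan_through_affine phiK two_neq0 UP uP nP ns ew (x := x)); rewrite ex mulrA.
Qed.

(** For w = r eps / s with r in F_q, the element w s is purely imaginary and Tr w = - r t, where t =
    eps imag s / (s phi s) lies in F_q. Taking r = 1 / (l t) gives both trace conditions without
    affecting the character. *)
Lemma triple_quad_of_chi s eps k l :
    imag phi s != 0 -> eps != 0 -> phi eps = - eps ->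
    phi k = k -> phi l = l -> k != 0 -> l != 0 -> k ^+ 2 != l ^+ 2 ->
    chi (a * eps * s * ((s ^+ 2 - k ^+ 2) * (s ^+ 2 - l ^+ 2))) = 1 ->
  exists A B C D, triple_quad U A B C D /\ collinear (T_infty F) A B.
Proof.
move=> ns neps eeps ek el nk nl nkl c.
have ek' : phi (- k) = - k by rewrite rmorphN ek.
have el' : phi (- l) = - l by rewrite rmorphN el.
have n1 := imag_neq0_add ek ns; have n2 := imag_neq0_add ek' ns.
have n3 := imag_neq0_add el ns; have n4 := imag_neq0_add el' ns.
have ns0 := imag_neq0_add (rmorph0 phi) ns; rewrite addr0 in ns0.
have ns1 : phi s != 0 by rewrite fmorph_eq0.
have nv : (s ^+ 2 - k ^+ 2) * (s ^+ 2 - l ^+ 2) != 0.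
  by rewrite !subr_sqr !mulf_neq0.
pose t := eps * imag phi s / (s * phi s).
have nt : t != 0 by rewrite !mulf_neq0 // invr_eq0 mulf_neq0.
have et : phi t = t.
  by rewrite /t /imag !(rmorphM, rmorphB, fmorphV) eeps phiK; field; rewrite ns0 ns1.
have [r [nr er rE]] : exists r, [/\ r != 0, phi r = r & l * t * r = 1].
  exists (l * t)^-1; rewrite invr_eq0 mulf_neq0 // fmorphV rmorphM el et.
  by split=> //; rewrite divff // mulf_neq0.
have [||x ex] := @sqr_quotient (r * eps / s * ((s ^+ 2 - k ^+ 2) * (s ^+ 2 - l ^+ 2))).
- by rewrite mulf_neq0 // !mulf_neq0 // invr_eq0.
- by rewrite -[RHS]c !chiM chiV // (chi_fixed er nr); ring.
apply: (@triple_quad_exists _ _ phiK two_neq0 a b U UP s k l (r * eps / s) x ns ek el nk nkl).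
- by rewrite divfK // rmorphM er eeps mulrN subrr.
- rewrite !rmorphM fmorphV er eeps -rE /t /imag; field.
  by rewrite ns0 ns1.
- by rewrite ex mulrA.
Qed.

(** The characters of g and g^2 differ, so one of them serves as s with chi (a eps s) = 1. The
    squares of h 0, h 1, h 2 are distinct because q - 1 >= 6 divides neither 2 nor 4. Two of the
    three s^2 - h i^2 then have equal character, and their product is a square. *)
Lemma triple_quad_exists_ge7 : (7 <= q)%N ->
  exists A B C D, triple_quad U A B C D /\ collinear (T_infty F) A B.
Proof.
move=> q7; have [g prim_g] := primitive_element.
have ng := prim_neq0 prim_g.
have ng1 : imag phi g != 0 by rewrite -[g]expr1; apply: imag_prim_pow => //; lia.
have ng2 : imag phi (g ^+ 2) != 0 by apply: imag_prim_pow => //; lia.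
have [s [ns cs]] : exists s, imag phi s != 0 /\ chi (a * imag phi g * s) = 1.
  have [e|e] := chi_pm (mulf_neq0 a_neq0 ng1).
    by exists (g ^+ 2); rewrite chiM e chiX chi_prim // mul1r sqrrN expr1n.
  by exists g; rewrite chiM e chi_prim // mulrNN mul1r.
pose h i := g ^+ (i * (q + 1)).
have eh i : phi (h i) = h i by exact: norm_prim_fixed.
have nh i : h i != 0 by rewrite expf_neq0.
have nhh i j : (i < j)%N -> (j < i + 3)%N -> h i ^+ 2 != h j ^+ 2.
  move=> ij ji; rewrite -subr_eq0.
  rewrite (_ : _ - _ = h i ^+ 2 * (1 - h (2 * (j - i))%N)); last first.
    rewrite mulrBr mulr1 /h -!exprM -exprD; congr (_ - g ^+ _).
    by rewrite -!mulnA !(mulnC (q + 1)%N) !mulnA -mulnDl; congr (_ * _)%N; lia.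
  rewrite mulf_neq0 ?expf_neq0 // subr_eq0 eq_sym norm_prim_eq1 //.
  by apply/negP=> /dvdn_leq; lia.
have nv i : s ^+ 2 - h i ^+ 2 != 0.
  have ehN : phi (- h i) = - h i by rewrite rmorphN eh.
  by rewrite subr_sqr mulf_neq0 ?(imag_neq0_add (eh i) ns) ?(imag_neq0_add ehN ns).
have same i j : (i < j)%N -> (j < i + 3)%N ->
    chi (s ^+ 2 - h i ^+ 2) = chi (s ^+ 2 - h j ^+ 2) ->
    exists A B C D, triple_quad U A B C D /\ collinear (T_infty F) A B.
  move=> ij ji e; apply: (@triple_quad_of_chi s (imag phi g) (h i) (h j)) => //.
  - exact: phi_imag.
  - exact: nhh.
  - by rewrite chiM cs mul1r chiM e chi_sqr.
have [e0|e0] := chi_pm (nv 0%N); have [e1|e1] := chi_pm (nv 1%N);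
  have [e2|e2] := chi_pm (nv 2%N);
  first [by apply: (same 0%N 1%N); rewrite ?e0 ?e1 | by apply: (same 0%N 2%N); rewrite ?e0 ?e2
        | by apply: (same 1%N 2%N); rewrite ?e1 ?e2].
Qed.

(** With k^2 = 1 and l^2 = -1 the product is s^4 - 1, and s (s^4 - 1) = - imag s. For eps = imag s
    this leaves a times an element of F_q. *)
Lemma triple_quad_exists_5 : q = 5%N -> chi a = 1 ->
  exists A B C D, triple_quad U A B C D /\ collinear (T_infty F) A B.
Proof.
move=> q5 ca; have [g prim_g] := primitive_element.
have ng := prim_neq0 prim_g.
have ng1 : imag phi g != 0 by rewrite -[g]expr1; apply: imag_prim_pow => //; lia.
pose h i := g ^+ (i * (q + 1)).
have eh : phi (h 1%N) = h 1%N by exact: norm_prim_fixed.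
have hX i : h 1%N ^+ i = h i by rewrite /h -exprM; congr (_ ^+ _); lia.
have h2 : h 1%N ^+ 2 = -1.
  have n2 : h 2%N != 1 by rewrite norm_prim_eq1 // q5.
  have /eqP e4 : h 4%N == 1 by rewrite norm_prim_eq1 // q5.
  have /eqP := e4; rewrite -hX (exprM _ 2 2) hX sqrf_eq1 (negPf n2) /=.
  by move=> /eqP.
apply: (@triple_quad_of_chi g (imag phi g) 1 (h 1%N)) => //.
- exact: phi_imag.
- exact: rmorph1.
- exact: oner_neq0.
- by rewrite expf_neq0.
- by rewrite h2 expr1n -subr_eq0 opprK -mulr2n.
- have -> : a * imag phi g * g * ((g ^+ 2 - 1 ^+ 2) * (g ^+ 2 - h 1%N ^+ 2)) =
      a * (- imag phi g ^+ 2).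
    by rewrite h2 /imag !phiE q5; ring.
  rewrite chiM ca mul1r; apply: chi_fixed; last by rewrite oppr_eq0 expf_neq0.
  by rewrite rmorphN rmorphXn phi_imag sqrrN.
Qed.

(** The only nonzero square of F_3 is 1, and those of F_5 are 1 and -1. *)
Lemma small_fixed_sqr k l : q = 3%N \/ q = 5%N ->
    phi k = k -> phi l = l -> k != 0 -> l != 0 -> k ^+ 2 != l ^+ 2 ->
  q = 5%N /\ (forall x, (x - k ^+ 2) * (x - l ^+ 2) = x ^+ 2 - 1).
Proof.
move=> q35 ek el nk nl; have := expf_fixed ek nk; have := expf_fixed el nl.
case: q35 => q_eq; rewrite q_eq /= => l1 k1; first by rewrite l1 k1 eqxx.
move=> ne; split=> // x.
have e : k ^+ 2 + l ^+ 2 = 0.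
  apply: (@mulfI _ (k ^+ 2 - l ^+ 2)); first by rewrite subr_eq0.
  by rewrite -subr_sqr mulr0 -!exprM k1 l1 subrr.
rewrite (_ : l ^+ 2 = - k ^+ 2); last by apply/eqP; rewrite -addr_eq0 addrC e.
by rewrite -k1; ring.
Qed.

(** Only q = 5 can occur, and then s^4 - 1 = - imag s / s. Multiplying the purely imaginary w s by -
    imag s gives an element of F_q equal to a (x s)^2, so a is a square. *)
Lemma small_triple_quad_chi A B C D : q = 3%N \/ q = 5%N -> anisotropic phi a b ->
  triple_quad U A B C D -> collinear (T_infty F) A B -> chi a = 1.
Proof.
move=> q35 aniso tq col.
have [s [k [l [x [[ns ek el] [nk nl nkl] nx]]]]] :=
  triple_quad_nec phiK two_neq0 UP aniso tq col.
have [q5 ->] := small_fixed_sqr q35 ek el nk nl nkl; cbv zeta => e.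
have ns0 := imag_neq0_add (rmorph0 phi) ns; rewrite addr0 in ns0.
have ss : s ^+ 2 ^+ 2 - 1 = - imag phi s / s.
  by rewrite /imag phiE q5; field.
have nw : s ^+ 2 ^+ 2 - 1 != 0 by rewrite ss mulf_neq0 ?oppr_eq0 ?invr_eq0.
pose w := a * x ^+ 2 / (s ^+ 2 ^+ 2 - 1) * s.
have : chi (- imag phi s * w) = 1.
  apply: chi_fixed; last by rewrite !mulf_neq0 ?oppr_eq0 ?invr_eq0 ?expf_neq0.
  rewrite rmorphM rmorphN phi_imag opprK (_ : phi w = - w) ?mulrN ?mulNr //.
  by apply/eqP; rewrite -addr_eq0 addrC; apply/eqP.
have -> : - imag phi s * w = a * (x * s) ^+ 2.
  have -> : - imag phi s = (s ^+ 2 ^+ 2 - 1) * s by rewrite ss divfK.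
  by rewrite /w; field.
by rewrite chiM chiX expr2 chi_sqr ?mulr1 // mulf_neq0.
Qed.

End ParametersExist.

(** B and B + N are distinct non-squares of F_q; for B this holds since its roots, imag b and its
    opposite, are negated by [phi]. F_3 has a single non-square. In F_5 the non-squares are opposite
    with square -1, so N = -2 B and N^2 = -4 = 1. Hence (a phi a)^2 = 1, which is chi a = 1. *)
Lemma small_nonconic_chi a b : q%:R = 0 :> F -> q = 3%N \/ q = 5%N -> a != 0 ->
    (forall t, phi t = t -> t ^+ 2 <> imag phi b ^+ 2 + 4%:R * (a * phi a)) ->
  imag phi b != 0 -> q = 5%N /\ chi a = 1.
Proof.
move=> q0 q35 na; set N := 4%:R * _; set B := imag phi b ^+ 2 => nsq nb.
have eB : phi B = B by rewrite rmorphXn phi_imag sqrrN.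
have eN : phi N = N by rewrite /N !rmorphM rmorph_nat phiK (mulrC (phi a)).
have ed : phi (B + N) = B + N by rewrite rmorphD eB eN.
have nN : N != 0 by rewrite !mulf_neq0 ?fmorph_eq0 // (natrM _ 2 2) mulf_neq0.
have nB : B != 0 by rewrite expf_neq0.
have nB_sqr t : phi t = t -> B != t ^+ 2.
  move=> et; rewrite /B eqf_sqr; apply/norP; split; apply: contra nb => /eqP e.
    have := phi_imag b; rewrite e et => /eqP; rewrite -subr_eq0 opprK -mulr2n -mulr_natl.
    by rewrite mulf_eq0 (negPf two_neq0).
  have := phi_imag b; rewrite e rmorphN et => /eqP.
  by rewrite -subr_eq0 -opprD oppr_eq0 opprK -mulr2n -mulr_natl mulf_eq0
    oppr_eq0 (negPf two_neq0).
have nd : B + N != 0.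
  by apply/eqP=> e; apply: (nsq 0 (rmorph0 phi)); rewrite e expr0n.
have nd1 : B + N != 1.
  by apply/eqP=> e; apply: (nsq 1 (rmorph1 phi)); rewrite e expr1n.
have nB1 : B != 1 by rewrite -(expr1n F 2) nB_sqr // rmorph1.
have := expf_fixed ed nd; have := expf_fixed eB nB.
case: q35 q0 => q_eq; rewrite q_eq /= => q0 eB4 ed4.
  case/negP: nN; move/eqP: eB4; rewrite sqrf_eq1 (negPf nB1) /= => /eqP eB1.
  by move/eqP: ed4; rewrite sqrf_eq1 (negPf nd1) /= eB1 -subr_eq0 addrAC subrr add0r.
split=> //; have m1 : -1 = 2%:R ^+ 2 :> F.
  by apply/eqP; rewrite -subr_eq0 -oppr_eq0 -q0; apply/eqP; ring.
have nBm : B != -1 by rewrite m1 nB_sqr // rmorph_nat.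
have ndm : B + N != -1.
  by apply/eqP=> e; apply: (nsq 2%:R (rmorph_nat _ _)); rewrite e m1.
have sq x : x ^+ 4 = 1 -> x != 1 -> x != -1 -> x ^+ 2 = -1.
  move=> /eqP e n1 n2; have : x ^+ 2 == 1 = false by rewrite sqrf_eq1 (negPf n1) (negPf n2).
  by move: e; rewrite (exprM _ 2 2) sqrf_eq1 => /orP[-> //|/eqP].
have : (B + N) ^+ 2 == B ^+ 2 by rewrite !sq.
rewrite eqf_sqr -subr_eq0 addrAC subrr add0r (negPf nN) /= => /eqP eNB.
have eN2 : N = - 2%:R * B.
  by apply: (eq_lincomb eNB); ring.
have N1 : (a * phi a) ^+ 2 = 1.
  have : N ^+ 2 = 1 + 5%:R * -1 by rewrite eN2 exprMn (sq B) //; ring.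
  rewrite q0 mul0r addr0 /N exprMn (_ : 4%:R ^+ 2 = 1 + 3%:R * 5%:R); last by ring.
  by rewrite q0 mulr0 addr0 mul1r.
by rewrite /chi cardF q_eq -N1 phiE q_eq -exprS -exprM.
Qed.

End QuadraticCharacter.

(** * The unitals U_{a,b}: equation, the case of real b, and the classical case a = 0 *)

Section BMUnital.
Variables (q : nat) (F : finFieldType) (phi : {rmorphism F -> F}).
Hypotheses (phiE : forall x, phi x = x ^+ q) (phiK : involutive phi).
Implicit Types a b : F.

Lemma BM_unitalP a b P : P \in BM_unital q a b <-> P = T_infty F \/
  exists x y, has_coords P x y 1 /\ affine_unital phi a b x y.
Proof.
have fixE r : (r \in in_Fq q) = (phi r == r) by rewrite inE phiE.
rewrite inE; split.
  case/orP=> [/eqP | /existsP[x /existsP[r /andP[]]]]; first by left.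
  rewrite fixE => /eqP er hP; right; exists x, (a * x ^+ 2 + b * x ^+ q.+1 + r).
  split=> //; rewrite /affine_unital phiE -exprS -subr_eq0; apply/eqP.
  by rewrite /imag rmorphD er; ring.
case=> [->|[x [y [hP /eqP v]]]]; first by rewrite eqxx.
apply/orP; right; apply/existsP; exists x; apply/existsP.
exists (y - (a * x ^+ 2 + b * (x * phi x))); apply/andP; split.
  by rewrite fixE; apply/eqP/phi_eq_imag.
by rewrite (exprS x q) -phiE addrC subrK.
Qed.

Lemma BM_unital_real a b P : imag phi b = 0 ->
  (P \in BM_unital q a b) = (P \in BM_unital q a 0).
Proof.
move=> eb; have eU x y : affine_unital phi a b x y = affine_unital phi a 0 x y.
  rewrite /affine_unital; congr (_ == _).
  transitivity (imag phi (a * x ^+ 2) + imag phi b * (x * phi x)).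
    by rewrite /imag !(rmorphD, rmorphM) phiK; ring.
  by rewrite eb !mul0r !addr0.
apply/idP/idP=> /BM_unitalP[e | [x [y [hP v]]]]; apply/BM_unitalP; try by left.
  by right; exists x, y; rewrite -eU.
by right; exists x, y; rewrite eU.
Qed.

Lemma BM_parameters_nonsquare a b : BM_parameters q a b ->
  forall t, phi t = t -> t ^+ 2 <> imag phi b ^+ 2 + 4%:R * (a * phi a).
Proof.
case=> _ nsq t et; rewrite phiE -exprS /imag phiE; apply: nsq.
by rewrite inE -phiE et.
Qed.

(** The homogenized equation of U_{0,b} is skew-Hermitian. Multiplying it by be = imag b, which
    [phi] negates, gives the Hermitian form of [H]; [K] is the inverse of [H]. *)
Lemma BM_unital_0_classical b : (2 : F) != 0 -> imag phi b != 0 ->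
  classical q (BM_unital q 0 b).
Proof.
move=> two_neq0; set be := imag phi b => nb.
have ebe : phi be = - be by rewrite /be /imag rmorphB phiK opprB.
pose H : 'M[F]_3 := \matrix_(i < 3, j < 3)
  (nth [::] [:: [:: - be ^+ 2; 0; 0]; [:: 0; 0; be]; [:: 0; - be; 0]] i)`_j.
pose K : 'M[F]_3 := \matrix_(i < 3, j < 3)
  (nth [::] [:: [:: - be ^- 2; 0; 0]; [:: 0; 0; - be^-1]; [:: 0; be^-1; 0]] i)`_j.
exists H; split.
- apply: (proj1 (@mulmx1_unit _ _ H K _)).
  apply/matrixP=> -[[|[|[|i]]] //= hi] -[[|[|[|j]]] //= hj];
    by rewrite !mxE !big_ord_recl big_ord0 !mxE /=; field.
- apply/matrixP=> -[[|[|[|i]]] //= hi] -[[|[|[|j]]] //= hj];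
    by rewrite !mxE /= -phiE ?rmorph0 ?rmorphN ?rmorphXn ?ebe ?sqrrN ?opprK.
move=> P v eP.
have hP : has_coords P (v 0 0) (v 0 1) (v 0 (inord 2)).
  by rewrite /has_coords -vec3_coords eP.
move: (v 0 0) (v 0 1) (v 0 (inord 2)) hP (vec3_coords v) => x y z hP ev.
have eH : (v *m H *m (conj_mx q v)^T) 0 0 =
    be * (y * phi z - z * phi y) - be ^+ 2 * (x * phi x).
  rewrite ev !mxE !big_ord_recl big_ord0 !mxE !big_ord_recl !big_ord0 !mxE /=.
  by rewrite -!phiE; ring.
have -> : (v *m H *m (conj_mx q v)^T == 0) =
    (be * (y * phi z - z * phi y) - be ^+ 2 * (x * phi x) == 0).
  rewrite -eH; apply/eqP/eqP=> [-> | e]; first by rewrite mxE.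
  by apply/matrixP=> i j; rewrite !ord1 e mxE.
have UP := BM_unitalP 0 b.
have [z0 | nz] := eqVneq z 0.
  rewrite z0 rmorph0 mulr0 mul0r subrr mulr0 sub0r oppr_eq0 !mulf_eq0 !(negPf nb) /=.
  rewrite fmorph_eq0 orbb; apply/idP/eqP => [/UP[e|[x' [y' [h _]]]] | x0].
  - have [k [-> _ _]] : exists k, [/\ x = k * 0, y = k * 1 & z = k * 0].
      by apply: (eq_point_coords hP); rewrite e has_coords_T_infty.
    by rewrite mulr0.
  - have [k [_ _ /eqP]] := eq_point_coords h hP.
    by rewrite z0 mulr0 oner_eq0.
  - apply/UP; left; rewrite x0 z0 in hP.
    have ny : y != 0.
      by have := has_coords_neq0 hP; rewrite vec3_eq0 eqxx andbT.
    have := has_coordsZ (invr_neq0 ny) hP; rewrite !mulr0 mulVf // => h.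
    exact: (has_coords_inj h (has_coords_T_infty F)).
have := has_coordsZ (invr_neq0 nz) hP; rewrite mulVf // !(mulrC z^-1) => h.
have nz' : phi z != 0 by rewrite fmorph_eq0.
have -> : (P \in BM_unital q 0 b) = affine_unital phi 0 b (x / z) (y / z).
  apply/idP/idP=> [/UP[e|[x' [y' [h']]]] | v0].
  - by have := affine_neq_T_infty h; rewrite e eqxx.
  - by have [-> ->] := affine_coords_inj h h'.
  - by apply/UP; right; exists (x / z), (y / z).
rewrite affine_unital_div // -subr_eq0 -(mulrI_eq0 _ (mulfI nb)); congr (_ == _).
by rewrite -/be /imag !(rmorphM, rmorph0, fmorphV); ring.
Qed.
End BMUnital.

Theorem theorem6 (p n q : nat) (F : finFieldType) (a b : F)
  (p_prime : prime p) (n_gt0 : (0 < n)%N) (q_def : q = (p ^ n)%N)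
  (q_odd : odd q) (cardF : #|F| = (q ^ 2)%N)
  (ab_params : BM_parameters q a b)
  (ab_nonclassical : ~ classical q (BM_unital q a b)) :
  (exists T : {pred line F}, triple_ONan (BM_unital q a b) T /\ BM_special T)
  <->
  ~ (conic_unital q (BM_unital q a b) /\ (q = 3%N \/ q = 5%N)).
Proof.
have [phi [phiE phiK]] := finite_conjugation p_prime q_def cardF.
have two_neq0 := finite_two_neq0 p_prime n_gt0 q_def q_odd cardF.
have q0 := finite_natq_eq0 p_prime n_gt0 q_def cardF.
have q_gt1 : (1 < q)%N.
  by rewrite q_def -(exp1n n) ltn_exp2r // prime_gt1.
have nz (c d : F) : BM_parameters q c d -> ~ classical q (BM_unital q c d) -> c != 0.
  move=> par ncl; apply/eqP=> c0; apply: ncl; rewrite c0 in par *.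
  apply: (BM_unital_0_classical phiE phiK) => //.
  apply/eqP=> e; apply: (BM_parameters_nonsquare phiE par (rmorph0 phi)).
  by rewrite e mul0r mulr0 addr0.
have na := nz _ _ ab_params ab_nonclassical.
have nsq := BM_parameters_nonsquare phiE ab_params.
have UP (c d : F) := BM_unitalP phiE c d.
rewrite BM_special_triple; split.
  move=> [A [B [C [D [tq col]]]]] [[c [par ncl [f [f_auto fUV]]]] q35].
  have nc := nz _ _ par ncl.
  have nsqc := BM_parameters_nonsquare phiE par.
  (* Otherwise the image of T_infty is an affine point of U_{c,0}, and pulling back an O'Nan
     configuration through it gives one through T_infty. *)
  have fT : f (T_infty F) = T_infty F.
    apply/eqP/negPn/negP => ne; apply: (no_ONan_through_T_infty phiK (UP a b)).
      exact: nonsquare_anisotropic.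
    apply: (ONan_through_automorphism f_auto fUV).
    apply: (ONan_through_affine_point phiE phiK q_odd q_gt1 cardF two_neq0 nc (UP c 0)) ne.
    by rewrite fUV; apply/UP; left.
  have cc : chi c = 1.
    apply: (small_triple_quad_chi phiE phiK q_odd q_gt1 cardF two_neq0 nc (UP c 0) q35
      _ (triple_quad_automorphism f_auto fUV tq)).
      exact: nonsquare_anisotropic.
    by rewrite -fT; apply/(collinear_automorphism f_auto).
  (* From c = y^2 the discriminant 4 c^(q+1) is the square of 2 y^(q+1), an element of F_q. *)
  have [y cE] := chi_square q_odd q_gt1 cardF nc cc.
  apply: (nsqc (2%:R * (y * phi y))).
    by rewrite !rmorphM rmorph_nat phiK (mulrC (phi y)).
  by rewrite /imag cE rmorph0 rmorphXn; ring.
move=> nconic.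
have [q7|q_small] := leqP 7 q.
  exact: (triple_quad_exists_ge7 phiE phiK q_odd q_gt1 cardF two_neq0 na (UP a b)).
have q35 : q = 3%N \/ q = 5%N by lia.
have [q5 ca] : q = 5%N /\ chi a = 1.
  apply: (small_nonconic_chi phiE phiK q_gt1 cardF two_neq0 q0 q35 na nsq).
  (* If Im b = 0, then U_{a,b} is the same set as U_{a,0}, hence conic through the identity
     automorphism. *)
  apply/eqP=> eb; apply: nconic; split; last exact: q35.
  have eU P := BM_unital_real phiE phiK a P eb.
  exists a; split.
  - case: ab_params; rewrite /BM_parameters /nonsquare_in_Fq -!phiE -/(imag phi b) eb.
    by rewrite rmorph0 subrr.
  - move=> [H [uH hH vH]]; apply: ab_nonclassical; exists H.
    by split; [exact: uH | exact: hH | move=> P v ev; rewrite eU; apply: vH].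
  - exists id; split; last by move=> P; exact: esym (eU P).
    by split; [exists id | exists id; split; [exists id |]].
exact: (triple_quad_exists_5 phiE phiK q_odd q_gt1 cardF two_neq0 na (UP a b)).
Qed.
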